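(* Let $p$ be a prime number and let $(R,\mathfrak{m})$ be a Noetherian complete local domain of mixed characteristic $(0,p)$ with $\dim(R)\geq 2$. Let $R^+$ be the absolute integral closure of $R$, with maximal ideal $\mathfrak{m}_{R^+}$, and let $\widehat{R^+}$ be its $p$-adic completion. Let $v$ be any $\mathbb{R}$-valuation on $\widehat{R^+}$ whose center on $R^+$ contains $p$ and is not $\mathfrak{m}_{R^+}$, normalized so that $v(p)=1$. Then there exists $0\neq g\in\widehat{R^+}$ such that $v(g)=\infty$ (i.e., $g$ is in the support of $v$). More precisely, if $x\in\mathfrak{m}_{R^+}$ is such that $p,x$ is a regular sequence on $R^+$ and $x$ is not in the center of $v$, then $g$ can be taken as the ($p$-adic) limit of a sequence $\{g_i\}_{i=1}^\infty$ in $R^+$ such that (1) $g_1$ satisfies the equation $T^2+xT+p^2=0$; (2) $g_i=p^{i+1}/s_i$ for some $s_i\in R^+$ with $v(s_i)=0$, for every $i\geq 1$; (3) $g_{i+1}=g_i+p^ih_i$, where $h_i\in R^+$ is a root of the equation $T^2+s_iT+p=0$, for every $i\geq 1$. In particular, there exists $g\in\widehat{R^+}$ such that $\widehat{R^+}/g\widehat{R^+}$ is not $p$-adically separated.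
   Context: All rings are commutative with $1$. Mixed characteristic $(0,p)$ means that $R$ has characteristic $0$ and its residue field has characteristic $p$. The absolute integral closure $R^+$ is the integral closure of $R$ in an algebraic closure of its fraction field; it is a local ring. The $p$-adic completion of a ring $S$ is $\widehat{S}=\varprojlim_n S/p^nS$. It is a known theorem (Heitmann) that $\widehat{R^+}$ is an integral domain. A module $M$ is $p$-adically separated if $\bigcap_n p^nM=0$. An $\mathbb{R}$-valuation $v$ on $\widehat{R^+}$ takes values in $\mathbb{R}\cup\{\infty\}$; it is allowed to take the value $\infty$ on nonzero elements, and its support is the prime ideal $\{z: v(z)=\infty\}$. Having a center means that $v\geq 0$ on the ring, and the center of $v$ on $R^+$ is the prime ideal $\{z\in R^+ : v(z)>0\}$. *)

(* Defs.v *)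
From HB Require Import structures.
From mathcomp Require Import all_boot all_order all_algebra.
From mathcomp Require Import generic_quotient ring_quotient fraction mxpoly.
From mathcomp Require Import all_classical all_reals.

Set Implicit Arguments.
Unset Strict Implicit.
Unset Printing Implicit Defensive.

Import Order.TTheory GRing.Theory Num.Theory.
Local Open Scope classical_set_scope.
Local Open Scope ring_scope.
Local Open Scope quotient_scope.

(* [idealr S] carries its ideal by a boolean predicate; with excluded middle  *)
(* these are all the proper ideals of [S].                                    *)

Section Ideals.
Variable S : comNzRingType.

Definition maximal_ideal (m : idealr S) : Prop :=
  forall I : idealr S, {subset m <= I} -> {subset I <= m}.

Definition local_ring (m : idealr S) : Prop :=
  maximal_ideal m /\ forall n : idealr S, maximal_ideal n -> n =i m.

Definition gen_ideal (rs : seq S) : set S :=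
  [set z | exists c : nat -> S, z = \sum_(i < size rs) c i * rs`_i].

(* The unit ideal, which [idealr] excludes, is always finitely generated.     *)
Definition noetherian : Prop :=
  forall I : idealr S, exists rs : seq S, forall z, z \in I <-> gen_ideal rs z.

Definition krull_dim_ge (n : nat) : Prop :=
  exists P : nat -> prime_idealr S, forall i, (i < n)%N ->
    {subset P i <= P i.+1} /\ ~ {subset P i.+1 <= P i}.

Definition ideal_pow (I : idealr S) (n : nat) : set S :=
  [set z | exists (k : nat) (c : 'I_k -> S) (y : 'I_k -> 'I_n -> S),
     (forall i j, y i j \in I) /\ z = \sum_i c i * \prod_j y i j].

(* Bijectivity of the map from S to the inverse limit of the S / I^n.         *)
Definition adically_complete (I : idealr S) : Prop :=
  (forall z, (forall n, ideal_pow I n z) -> z = 0) /\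
  (forall u : nat -> S, (forall n, ideal_pow I n (u n.+1 - u n)) ->
     exists l, forall n, ideal_pow I n (l - u n)).

Definition regular_sequence (rs : seq S) : Prop :=
  (forall i, (i < size rs)%N -> forall z,
     gen_ideal (take i rs) (rs`_i * z) -> gen_ideal (take i rs) z) /\
  ~ gen_ideal rs 1.

(* The second clause is p = 0 in the residue ring, for p prime.               *)
Definition mixed_char (p : nat) (m : idealr S) : Prop :=
  [pchar S] =i pred0 /\ p \in [pchar {ideal_quot m}].

End Ideals.

(* [{ideal_quot I}] is a ring only for proper ideals, while S / p^0 S is the   *)
(* zero ring; hence the ring structure below, without the axiom 1 != 0.       *)
Section PrincipalQuotient.
Variable S : comPzRingType.

Definition principal (a : S) : {pred S} := fun x => `[< exists y, x = a * y >].

Lemma principalP a x : reflect (exists y, x = a * y) (x \in principal a).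
Proof. exact: asboolP. Qed.

Fact principal_zmod_closed a : zmod_closed (principal a).
Proof.
split; first by apply/principalP; exists 0; rewrite mulr0.
move=> x y /principalP[x' ->] /principalP[y' ->].
by apply/principalP; exists (x' - y'); rewrite mulrBr.
Qed.

HB.instance Definition _ a :=
  GRing.isZmodClosed.Build S (principal a) (principal_zmod_closed a).

Lemma principalMl a x y : y \in principal a -> x * y \in principal a.
Proof.
by move=> /principalP[z ->]; apply/principalP; exists (x * z); rewrite mulrCA.
Qed.

Variable a : S.

Definition pquot : Type := Quotient.quot (principal a).
HB.instance Definition _ := GRing.Zmodule.on pquot.

Definition to_pquot (x : S) : pquot := \pi_(Quotient.quot (principal a)) x.
Definition pquot_repr (c : pquot) : S :=
  repr (c : Quotient.quot (principal a)).

Lemma pquot_reprK : cancel pquot_repr to_pquot.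
Proof. by move=> c; rewrite /to_pquot /pquot_repr reprK. Qed.

Lemma to_pquotP x y : reflect (to_pquot x = to_pquot y) (x - y \in principal a).
Proof. by rewrite Quotient.idealrBE; exact: eqP. Qed.

Lemma to_pquotD x y : to_pquot (x + y) = to_pquot x + to_pquot y.
Proof. exact: (raddfD \pi_(Quotient.quot (principal a))). Qed.

Definition pquot_one : pquot := to_pquot 1.
Definition pquot_mul (c d : pquot) : pquot :=
  to_pquot (pquot_repr c * pquot_repr d).

Lemma to_pquotM x y : to_pquot (x * y) = pquot_mul (to_pquot x) (to_pquot y).
Proof.
have H z : z - pquot_repr (to_pquot z) \in principal a.
  by apply/to_pquotP; rewrite pquot_reprK.
apply/to_pquotP; set x' := pquot_repr _; set y' := pquot_repr _.
have -> : x * y - x' * y' = x * (y - y') + y' * (x - x').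
  by rewrite !mulrBr addrA [y' * x]mulrC subrK [y' * x']mulrC.
by rewrite rpredD ?principalMl.
Qed.

Fact pquot_mulA : associative pquot_mul.
Proof.
move=> c d e; rewrite -(pquot_reprK c) -(pquot_reprK d) -(pquot_reprK e).
by rewrite -!to_pquotM mulrA.
Qed.

Fact pquot_mulC : commutative pquot_mul.
Proof. by move=> c d; rewrite /pquot_mul mulrC. Qed.

Fact pquot_mul1 : left_id pquot_one pquot_mul.
Proof. by move=> c; rewrite -(pquot_reprK c) -to_pquotM mul1r. Qed.

Fact pquot_mulDl : left_distributive pquot_mul +%R.
Proof.
move=> c d e; rewrite -(pquot_reprK c) -(pquot_reprK d) -(pquot_reprK e).
by rewrite -!to_pquotM -!to_pquotD -to_pquotM mulrDl.
Qed.

HB.instance Definition _ := GRing.Zmodule_isComPzRing.Build pquot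
  pquot_mulA pquot_mulC pquot_mul1 pquot_mulDl.

Fact to_pquot_is_zmod_morphism : zmod_morphism to_pquot.
Proof. exact: (raddfB \pi_(Quotient.quot (principal a))). Qed.

Fact to_pquot_is_monoid_morphism : monoid_morphism to_pquot.
Proof. by split=> // x y; exact: to_pquotM. Qed.

HB.instance Definition _ :=
  GRing.isZmodMorphism.Build S pquot to_pquot to_pquot_is_zmod_morphism.
HB.instance Definition _ :=
  GRing.isMonoidMorphism.Build S pquot to_pquot to_pquot_is_monoid_morphism.

End PrincipalQuotient.

Section Completion.
Variables (p : nat) (S : comPzRingType).

Definition Smod (n : nat) : comPzRingType := pquot (p%:R ^+ n : S).

Definition Smod_red (n : nat) (c : Smod n.+1) : Smod n :=
  to_pquot (p%:R ^+ n) (pquot_repr c).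

Lemma Smod_redE n x :
  Smod_red (to_pquot (p%:R ^+ n.+1) x : Smod n.+1) = to_pquot (p%:R ^+ n) x.
Proof.
apply/to_pquotP.
have /to_pquotP/principalP[y ->] := pquot_reprK (to_pquot (p%:R ^+ n.+1 : S) x).
by apply/principalP; exists (p%:R * y); rewrite exprSr mulrA.
Qed.

Fact Smod_red_is_zmod_morphism n : zmod_morphism (@Smod_red n).
Proof.
move=> c d; rewrite -(pquot_reprK c) -(pquot_reprK d).
by rewrite -[in LHS]raddfB !Smod_redE raddfB.
Qed.

Fact Smod_red_is_monoid_morphism n : monoid_morphism (@Smod_red n).
Proof.
split=> [|c d]; first exact: (Smod_redE n 1).
rewrite -(pquot_reprK c) -(pquot_reprK d).
by rewrite -[in LHS]rmorphM !Smod_redE rmorphM.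
Qed.

HB.instance Definition _ n := GRing.isZmodMorphism.Build
  (Smod n.+1) (Smod n) (@Smod_red n) (@Smod_red_is_zmod_morphism n).
HB.instance Definition _ n := GRing.isMonoidMorphism.Build
  (Smod n.+1) (Smod n) (@Smod_red n) (@Smod_red_is_monoid_morphism n).

Record completion := Completion {
  cpl_seq :> forall n, Smod n;
  cpl_compat : forall n, Smod_red (cpl_seq n.+1) = cpl_seq n }.

HB.instance Definition _ := gen_eqMixin completion.
HB.instance Definition _ := gen_choiceMixin completion.

Lemma cpl_eqP (f g : completion) : (forall n, f n = g n) -> f = g.
Proof.
case: f g => [f fP] [g gP] /= fg.
have {fg} eq_fg : f = g by exact: functional_extensionality_dep.
by rewrite eq_fg in fP *; congr Completion; exact: Prop_irrelevance.
Qed.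

Fact cpl_zero_subproof n : Smod_red (0 : Smod n.+1) = 0.
Proof. exact: raddf0. Qed.
Definition cpl_zero := Completion cpl_zero_subproof.

Fact cpl_opp_subproof (f : completion) n : Smod_red (- f n.+1) = - f n.
Proof. by rewrite raddfN /= cpl_compat. Qed.
Definition cpl_opp f := Completion (cpl_opp_subproof f).

Fact cpl_add_subproof (f g : completion) n :
  Smod_red (f n.+1 + g n.+1) = f n + g n.
Proof. by rewrite raddfD /= !cpl_compat. Qed.
Definition cpl_add f g := Completion (cpl_add_subproof f g).

Fact cpl_one_subproof n : Smod_red (1 : Smod n.+1) = 1.
Proof. exact: rmorph1. Qed.
Definition cpl_one := Completion cpl_one_subproof.

Fact cpl_mul_subproof (f g : completion) n :
  Smod_red (f n.+1 * g n.+1) = f n * g n.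
Proof. by rewrite rmorphM /= !cpl_compat. Qed.
Definition cpl_mul f g := Completion (cpl_mul_subproof f g).

Fact cpl_addA : associative cpl_add.
Proof. by move=> f g h; apply: cpl_eqP => n; exact: addrA. Qed.
Fact cpl_addC : commutative cpl_add.
Proof. by move=> f g; apply: cpl_eqP => n; exact: addrC. Qed.
Fact cpl_add0 : left_id cpl_zero cpl_add.
Proof. by move=> f; apply: cpl_eqP => n; exact: add0r. Qed.
Fact cpl_addN : left_inverse cpl_zero cpl_opp cpl_add.
Proof. by move=> f; apply: cpl_eqP => n; exact: addNr. Qed.

HB.instance Definition _ := GRing.isZmodule.Build completion
  cpl_addA cpl_addC cpl_add0 cpl_addN.

Fact cpl_mulA : associative cpl_mul.
Proof. by move=> f g h; apply: cpl_eqP => n; exact: mulrA. Qed.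
Fact cpl_mulC : commutative cpl_mul.
Proof. by move=> f g; apply: cpl_eqP => n; exact: mulrC. Qed.
Fact cpl_mul1 : left_id cpl_one cpl_mul.
Proof. by move=> f; apply: cpl_eqP => n; exact: mul1r. Qed.
Fact cpl_mulDl : left_distributive cpl_mul +%R.
Proof. by move=> f g h; apply: cpl_eqP => n; exact: mulrDl. Qed.

HB.instance Definition _ := GRing.Zmodule_isComPzRing.Build completion
  cpl_mulA cpl_mulC cpl_mul1 cpl_mulDl.

Definition to_cpl (x : S) : completion := Completion (fun n => Smod_redE n x).

Fact to_cpl_is_zmod_morphism : zmod_morphism to_cpl.
Proof. by move=> x y; apply: cpl_eqP => n; exact: raddfB. Qed.
Fact to_cpl_is_monoid_morphism : monoid_morphism to_cpl.
Proof. by split=> [|x y]; apply: cpl_eqP => n //; exact: rmorphM. Qed.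

HB.instance Definition _ :=
  GRing.isZmodMorphism.Build S completion to_cpl to_cpl_is_zmod_morphism.
HB.instance Definition _ :=
  GRing.isMonoidMorphism.Build S completion to_cpl to_cpl_is_monoid_morphism.

End Completion.

Definition padic_limit (p : nat) (S : comPzRingType) (u : nat -> S) (l : S) :=
  forall n : nat, exists N : nat, forall i : nat, (N <= i)%N ->
    l - u i \in principal (p%:R ^+ n).

(* p^n M is the image of multiplication by the integer p^n.                   *)
Definition padically_separated (p : nat) (M : zmodType) : Prop :=
  forall z : M, (forall n : nat, exists y : M, z = y *+ (p ^ n)) -> z = 0.

Section AbsoluteIntegralClosure.
Variables (R : idomainType) (K : closedFieldType).
Variable phi : {rmorphism {fraction R} -> K}.

Definition algebraic_closure : Prop := forall z : K, algebraicOver phi z.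

Definition absint_pred : {pred K} :=
  fun z => `[< integralOver (phi \o @tofrac R) z >].

Fact absint_subring_closed : subring_closed absint_pred.
Proof.
split=> [|x y /asboolP Ix /asboolP Iy|x y /asboolP Ix /asboolP Iy]; apply/asboolP.
- exact: integral1.
- exact: integral_sub.
- exact: integral_mul.
Qed.

HB.instance Definition _ :=
  GRing.isSubringClosed.Build K absint_pred absint_subring_closed.

Record absint : Type :=
  Absint { absint_val :> K; absint_valP : absint_val \in absint_pred }.

HB.instance Definition _ := [isSub for absint_val].
HB.instance Definition _ := [Choice of absint by <:].
HB.instance Definition _ := [SubChoice_isSubComNzRing of absint by <:].

End AbsoluteIntegralClosure.

Section Valuation.
Variables (F : realType) (A : comPzRingType) (v : A -> \bar F).
Local Open Scope ereal_scope.

(* [+oo] is allowed on nonzero elements.                                      *)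
Definition is_Rvaluation : Prop :=
  [/\ forall z, v z != -oo,
      v 0%R = +oo,
      v 1%R = 0,
      forall z w, v (z * w)%R = v z + v w &
      forall z w, mine (v z) (v w) <= v (z + w)%R].

Definition has_center : Prop := forall z, 0 <= v z.

Definition center_on (S : Type) (f : S -> A) : set S := [set z | 0 < v (f z)].

End Valuation.

(* Main.v *)
(* A root [h] of [T ^ 2 + s T + p] with [v h = 1] is [p / h'], where the other
   root [h'] has value 0, and
     [p ^ (i + 1) / s + p ^ i h = p ^ (i + 2) / (- s h' ^ 2)],
   so the values of the [g_i] tend to infinity.  If their limit vanishes, then
   [g_1 = p y] for some [y], which contradicts the regularity of [p, x].  It
   also makes [x] an associate of [s_1 = - x - p y], a divisor of [p]; for the
   first claim it is thus enough that [x] does not divide [p], and by the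
   principal ideal theorem this holds for a high power of any nonunit of [R]
   outside of the center.

   For the quotient which is not separated there is no valuation to start from.
   Let [P] be a prime of [R] minimal over [p]; it is not maximal, so some [x] in
   the maximal ideal is not in [P].  There are infinitely many primes of [R^+]
   over [P]: for [b] in [P] and not in a prime [Q] minimal over [x], exactly one
   root of [T ^ d + x T + x b] lies in each of them, while these roots ramify
   without bound over [Q], so their degrees grow by the Krull-Akizuki theorem.  The construction above, made over these
   primes instead of [v], gives [s_i] and a limit [g] such that [p ^ i] divides
   [g s_i], and primes [q_i] over [P] at which [g] has finite order, such that
   [s_k] is in [q_i] for [k > i] and [s_k = +- x ^ (n_k)] modulo [q_i] for
   [k <= i].  If the sum of the [g s_k] were [g c], then [c] would be congruent
   to [s_0 + ... + s_i] modulo [q_i] for all [i]; a monic equation of [c] over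
   [R] would have infinitely many roots in the domain [R / P]. *)
Require Import Defs.
From HB Require Import structures.
From mathcomp Require Import all_boot all_order all_algebra.
From mathcomp Require Import generic_quotient ring_quotient fraction mxpoly.
From mathcomp Require Import all_classical all_reals.
From mathcomp Require Import ring.

Set Implicit Arguments.
Unset Strict Implicit.
Unset Printing Implicit Defensive.

Import Order.TTheory GRing.Theory Num.Theory.
Local Open Scope classical_set_scope.
Local Open Scope ring_scope.

(** * Ideals as sets, prime avoidance *)

Section SetIdeals.
Variable S : comNzRingType.
Implicit Types (I J P M : set S) (a b u x y z : S).

(** Unlike [idealr], this admits the unit ideal, which sums, colons and saturations may reach. *)
Definition set_ideal I :=
  [/\ I 0, forall x y, I x -> I y -> I (x + y) & forall a x, I x -> I (a * x)].

Definition set_prime P :=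
  [/\ set_ideal P, ~ P 1 & forall a b, P (a * b) -> P a \/ P b].

Definition ideal_add I a : set S := [set z | exists x r, I x /\ z = x + r * a].

Definition colon I a : set S := [set z | I (z * a)].

Lemma set_idealMl I a x : set_ideal I -> I x -> I (a * x).
Proof. by case=> _ _; apply. Qed.

Lemma set_idealMr I a x : set_ideal I -> I x -> I (x * a).
Proof. by move=> ? ?; rewrite mulrC; exact: set_idealMl. Qed.

Lemma set_idealD I x y : set_ideal I -> I x -> I y -> I (x + y).
Proof. by case=> _ + _; apply. Qed.

Lemma set_idealN I x : set_ideal I -> I x -> I (- x).
Proof. by move=> Ii Ix; rewrite -mulN1r; exact: set_idealMl. Qed.

Lemma set_idealB I x y : set_ideal I -> I x -> I y -> I (x - y).
Proof. by move=> Ii Ix Iy; apply: set_idealD => //; exact: set_idealN. Qed.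

Lemma set_ideal_addl I x y : set_ideal I -> I x -> I (x + y) -> I y.
Proof. by move=> Ii Ix Ixy; rewrite -(addKr x y) addrC; exact: set_idealB. Qed.

Lemma set_ideal_sum I (T : Type) (r : seq T) (Q : pred T) (F : T -> S) :
  set_ideal I -> (forall i, Q i -> I (F i)) -> I (\sum_(i <- r | Q i) F i).
Proof.
move=> Ii IF; elim/big_ind: _ => //; first by case: Ii.
by move=> x y; exact: set_idealD.
Qed.

Lemma set_idealX I x n : set_ideal I -> I x -> (0 < n)%N -> I (x ^+ n).
Proof. by case: n => // n Ii Ix _; rewrite exprS; exact: set_idealMr. Qed.

Lemma set_primeX P x n : set_prime P -> P (x ^+ n) -> P x.
Proof.
move=> [_ P1 Pm]; elim: n => [|n IHn]; first by rewrite expr0.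
by rewrite exprS => /Pm[].
Qed.

Lemma set_primeNX P x n : set_prime P -> ~ P x -> ~ P (x ^+ n).
Proof. by move=> Pp Px /(set_primeX Pp). Qed.

Lemma set_primeNM P x y : set_prime P -> ~ P x -> ~ P y -> ~ P (x * y).
Proof. by move=> [_ _ Pm] Px Py /Pm[]. Qed.

Lemma set_prime_prod P (T : Type) (r : seq T) (F : T -> S) :
  set_prime P -> P (\prod_(i <- r) F i) -> exists k, (k < size r)%N /\
    forall t0, P (F (nth t0 r k)).
Proof.
move=> Pp; elim: r => [|t r IHr]; first by rewrite big_nil; case: Pp.
rewrite big_cons => PF; have [_ _ Pm] := Pp; have [Pt|/IHr[k [kr PFk]]] := Pm _ _ PF.
  by exists 0%N; split.
by exists k.+1.
Qed.

Lemma ideal_add_ideal I a : set_ideal I -> set_ideal (ideal_add I a).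
Proof.
move=> Ii; split.
- by exists 0, 0; rewrite mul0r addr0; split=> //; case: Ii.
- move=> _ _ [x [r [Ix ->]]] [y [s [Iy ->]]].
  by exists (x + y), (r + s); split; [exact: set_idealD|ring].
- move=> b _ [x [r [Ix ->]]].
  by exists (b * x), (b * r); split; [exact: set_idealMl|ring].
Qed.

Lemma sub_ideal_add I a : I `<=` ideal_add I a.
Proof. by move=> x Ix; exists x, 0; rewrite mul0r addr0. Qed.

Lemma ideal_add_mem I a : set_ideal I -> ideal_add I a a.
Proof. by case=> I0 _ _; exists 0, 1; rewrite mul1r add0r. Qed.

Lemma colon_ideal I a : set_ideal I -> set_ideal (colon I a).
Proof.
move=> Ii; split; rewrite /colon /=.
- by rewrite mul0r; case: Ii.
- by move=> x y Ix Iy; rewrite mulrDl; exact: set_idealD.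
- by move=> b x Ix; rewrite -mulrA; exact: set_idealMl.
Qed.

Lemma sub_colon I a : set_ideal I -> I `<=` colon I a.
Proof. by move=> Ii x Ix; exact: set_idealMr. Qed.

(** By Zorn's lemma. Adjoining to the maximal ideal an element outside of it produces an element of
    [M]; for two such elements with product in the ideal, the product of the results would lie in
    the ideal and in [M]. *)
Lemma exists_prime_disjoint I M : set_ideal I ->
  M 1 -> (forall a b, M a -> M b -> M (a * b)) -> I `&` M = set0 ->
  exists P, [/\ set_prime P, I `<=` P, P `&` M = set0 &
    forall J, set_ideal J -> P `<=` J -> J `&` M = set0 -> J `<=` P].
Proof.
move=> Ii M1 MM IM.
(* The union of a possibly empty chain is not an ideal, hence [X !=set0 -> _]. *)
pose Phi X := X !=set0 -> [/\ set_ideal X, I `<=` X & X `&` M = set0].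
have [|A [PhiA Amax]] := @Zorn_bigcup S Phi.
  move=> F FP totF [z [X0 FX0 X0z]].
  have X00 : X0 !=set0 by exists z.
  have [[X00' _ _] IX0 _] := FP _ FX0 X00.
  split.
  - split.
    + by exists X0.
    + move=> x y [X FX Xx] [Y FY Yy].
      have [[_ XD _] _ _] := FP _ FX (ex_intro _ x Xx).
      have [[_ YD _] _ _] := FP _ FY (ex_intro _ y Yy).
      have [XY|YX] := totF _ _ FX FY.
        by exists Y => //; apply: YD => //; exact: XY.
      by exists X => //; apply: XD => //; exact: YX.
    + move=> a x [X FX Xx].
      by have [[_ _ XM] _ _] := FP _ FX (ex_intro _ x Xx); exists X => //; exact: XM.
  - by move=> x Ix; exists X0 => //; exact: IX0.
  - rewrite -subset0 => x [[X FX Xx] Mx].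
    have [_ _ XM] := FP _ FX (ex_intro _ x Xx).
    by rewrite -XM; split.
have A0 : A !=set0.
  apply: contrapT => nA; apply: (Amax I); last by move=> _; split.
  split=> [x Ax|IA]; first by case: nA; exists x.
  by apply: nA; exists 0; apply: IA; case: Ii.
have {PhiA} [Ai IA AM] := PhiA A0.
have {}Amax J : set_ideal J -> A `<=` J -> J `&` M = set0 -> J `<=` A.
  move=> Ji AJ JM; apply: contrapT => JA; apply: (Amax J) => // _; split => //.
  exact: subset_trans AJ.
exists A; split=> //; split=> //.
  by move=> A1; move: AM; rewrite -subset0; apply; split; first exact: A1.
move=> a b Aab.
have grow c : ~ A c -> exists x r, A x /\ M (x + r * c).
  move=> Ac; apply: contrapT => nx; apply: Ac; apply: (Amax (ideal_add A c)).
  - exact: ideal_add_ideal.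
  - exact: sub_ideal_add.
  - rewrite -subset0 => _ [[x [r [Ax ->]]] Mx].
    by apply: nx; exists x, r.
  - exact: ideal_add_mem.
apply: contrapT => /not_orP[/grow[x [r [Ax Mx]]] /grow[y [s [Ay My]]]].
have : (A `&` M) ((x + r * a) * (y + s * b)).
  split; last exact: MM.
  have -> : (x + r * a) * (y + s * b) = (y + s * b) * x + (r * a) * y + r * s * (a * b).
    by ring.
  by apply: set_idealD => //; [apply: set_idealD => //|]; exact: set_idealMl.
by rewrite AM.
Qed.

Lemma idealr_of_set I : set_ideal I -> ~ I 1 -> exists J : idealr S, forall z, z \in J <-> I z.
Proof.
move=> Ii I1.
pose X : {pred S} := fun z => `[< I z >].
have Xc : idealr_closed X.
  split; first by apply/asboolP; case: Ii.
    by apply/negP => /asboolP.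
  move=> a x y /asboolP Ix /asboolP Iy; apply/asboolP.
  by apply: set_idealD => //; exact: set_idealMl.
pose m := isIdealr.Build S X Xc.
pose J : idealr S := HB.pack X m.
by exists J => z; split => /asboolP.
Qed.

Lemma local_unit (m : idealr S) z : local_ring m -> z \notin m -> exists w, w * z = 1.
Proof.
move=> [_ mloc] zm; apply: contrapT => nz.
have Ii : set_ideal (ideal_add [set 0] z).
  apply: ideal_add_ideal; split => //= [x y -> ->|a x ->]; [exact: addr0|exact: mulr0].
have [//||P [[Pi P1 _] IP _ Pmax]] := @exists_prime_disjoint _ [set 1] Ii erefl.
- by move=> a b /= -> ->; rewrite mulr1.
- rewrite -subset0 => _ [[x [r [/= -> ->]]]] /= /esym.
  by rewrite add0r => /esym rz; apply: nz; exists r.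
have [J JP] := idealr_of_set Pi P1.
have Jmax : maximal_ideal J.
  move=> K JK x xK; apply/JP; apply: (Pmax [set y | y \in K]) => //.
  - split => /= [|y w yK wK|a y yK]; [exact: rpred0|exact: rpredD|exact: idealMr].
  - by move=> y /JP /JK.
  - by rewrite -subset0 => y [/= yK y1]; move: yK; rewrite y1 idealr1.
move: zm; rewrite -(mloc _ Jmax) => /negP; apply; apply/JP/IP.
by exists 0, 1; rewrite add0r mul1r.
Qed.

Lemma local_nonunit (m : idealr S) z w : z \in m -> w * z <> 1.
Proof. by move=> zm wz; have := idealMr w zm; rewrite wz idealr1. Qed.

End SetIdeals.

(** * The principal ideal theorem *)

Lemma chain_anti (T : Type) (J : nat -> set T) :
  (forall n, J n.+1 `<=` J n) -> forall m n, (m <= n)%N -> J n `<=` J m.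
Proof.
move=> JS m n /subnK <-; elim: (n - m)%N => // k IHk.
by apply: subset_trans IHk; exact: JS.
Qed.

Section Noetherian.
Variable R : idomainType.
Hypothesis noethR : noetherian R.
Implicit Types (I J K P Q : set R) (a b c r u w x y z : R).

Lemma noeth_fg I : set_ideal I -> exists rs : seq R, forall z, I z <-> gen_ideal rs z.
Proof.
move=> Ii; have [I1|I1] := pselect (I 1); last first.
  have [J JI] := idealr_of_set Ii I1; have [rs rsP] := noethR J.
  by exists rs => z; rewrite -rsP JI.
exists [:: 1] => z; split=> _; last by rewrite -[z]mulr1; exact: set_idealMl.
by exists (fun=> z); rewrite big_ord1 mulr1.
Qed.

Lemma noeth_max (Phi : set R -> Prop) :
  (forall I, Phi I -> set_ideal I) -> (exists I, Phi I) ->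
  exists M, Phi M /\ forall J, Phi J -> M `<=` J -> J `<=` M.
Proof.
move=> Phii [I0 PhiI0]; apply: contrapT => nmax.
have step (I : {I | Phi I}) : exists J : {J | Phi J}, sval I `<` sval J.
  apply: contrapT => nJ; apply: nmax; exists (sval I); split; first exact: (svalP I).
  move=> J PhiJ IJ; apply: contrapT => JI; apply: nJ.
  by exists (exist _ J PhiJ); split.
have [f fP] := choice step.
pose F n := sval (iter n f (exist _ I0 PhiI0)).
have Fi n : set_ideal (F n) by apply: Phii; exact: svalP.
have FS n : F n `<` F n.+1 by exact: fP.
have Fle m n : (m <= n)%N -> F m `<=` F n.
  move=> /subnK <-; elim: (n - m)%N => // k IHk.
  by apply: (subset_trans IHk); exact: (FS _).1.
have Ui : set_ideal (\bigcup_n F n).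
  split; first by exists 0%N => //; case: (Fi 0%N).
  - move=> x y [m _ Fx] [n _ Fy]; exists (maxn m n) => //.
    by apply: set_idealD => //; [apply: Fle Fx|apply: Fle Fy]; rewrite leq_max leqnn ?orbT.
  - by move=> a x [m _ Fx]; exists m => //; exact: set_idealMl.
have [rs rsP] := noeth_fg Ui.
have gen i : exists n, (i < size rs)%N -> F n rs`_i.
  have [ilt|] := boolP (i < size rs)%N; last by exists 0%N.
  have /rsP[n _ Fn] : gen_ideal rs rs`_i.
    exists (fun j => (j == i)%:R); rewrite (bigD1 (Ordinal ilt)) //= eqxx mul1r.
    rewrite big1 ?addr0 // => j; rewrite -val_eqE /= => /negbTE ->.
    by rewrite mul0r.
  by exists n.
have [g gP] := choice gen.
pose N := (\max_(i < size rs) g i)%N.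
apply: (FS N).2 => z Fz.
have /rsP[c ->] : (\bigcup_n F n) z by exists N.+1.
apply: set_ideal_sum => // i _; apply: set_idealMl => //.
by apply: Fle (gP i (ltn_ord i)); exact: leq_bigmax.
Qed.

Lemma noeth_sequence (r : nat -> R) :
  exists N (e : nat -> R), r N = \sum_(i < N) e i * r i.
Proof.
pose I n : set R := [set z | exists e : nat -> R, z = \sum_(i < n) e i * r i].
have Ii n : set_ideal (I n).
  split; first by exists (fun=> 0); rewrite big1 // => i _; rewrite mul0r.
  - move=> _ _ [e ->] [e' ->]; exists (fun i => e i + e' i).
    by rewrite -big_split; apply: eq_bigr => i _; rewrite mulrDl.
  - move=> a _ [e ->]; exists (fun i => a * e i).
    by rewrite mulr_sumr; apply: eq_bigr => i _; rewrite mulrA.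
have [||_ [[N ->] Nmax]] := @noeth_max (fun J => exists n, J = I n).
- by move=> _ [n ->].
- by exists (I 0%N), 0%N.
exists N; apply: (Nmax (I N.+1)) => [|_ [e ->]|].
- by exists N.+1.
- exists (fun i => if (i < N)%N then e i else 0).
  rewrite big_ord_recr /= ltnn mul0r addr0.
  by apply: eq_bigr => i _; rewrite ltn_ord.
- exists (fun i => (i == N)%:R).
  rewrite big_ord_recr /= eqxx mul1r big1 ?add0r // => i _.
  by rewrite (ltn_eqF (ltn_ord i)) mul0r.
Qed.

(* A prime minimal over [x], in the form: the image of [x] generates a        *)
(* primary ideal for the maximal ideal of the localisation at [P].            *)
Definition min_prime_over x P :=
  [/\ set_prime P, P x &
    forall b, P b -> exists k u r, ~ P u /\ u * b ^+ k = x * r].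

(** A maximal one among the proper colon ideals of the radical of [x] is prime. If it is the colon
    by [c] and contains [b], a power of [c], which lies outside of it, multiplies a power of [b]
    into the ideal of [x]. *)
Lemma exists_min_prime x : (forall w, w * x <> 1) -> exists P, min_prime_over x P.
Proof.
move=> xnu.
pose rad : set R := [set z | exists k r, z ^+ k = x * r].
have radi : set_ideal rad.
  split; first by exists 1%N, 0; rewrite expr1 mulr0.
  - move=> a b [k [r akr]] [l [s bls]]; exists (k + l)%N.
    rewrite /rad /= exprDn.
    have : forall i, exists r0, a ^+ (k + l - i) * b ^+ i = x * r0.
      move=> i; have [lei|lti] := leqP l i.
        have -> : b ^+ i = b ^+ (i - l) * (x * s) by rewrite -bls -exprD subnK.
        by exists (a ^+ (k + l - i) * (s * b ^+ (i - l))); ring.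
      exists (a ^+ (l - i) * b ^+ i * r).
      have -> : (k + l - i = (l - i) + k)%N by rewrite -addnBA ?(ltnW lti) // addnC.
      by rewrite exprD akr; ring.
    move=> /choice[f fP]; exists (\sum_(i < (k + l).+1) f i *+ 'C(k + l, i)).
    by rewrite mulr_sumr; apply: eq_bigr => i _; rewrite fP mulrnAr.
  - by move=> a z [k [r zk]]; exists k, (a ^+ k * r); rewrite exprMn zk; ring.
have rad1 : ~ rad 1 by move=> [k [r]]; rewrite expr1n mulrC => /esym; exact: xnu.
have [||_ [[c rc ->] cmax]] := @noeth_max (fun J => exists2 c, ~ rad c & J = colon rad c).
- by move=> _ [c _ ->]; exact: colon_ideal.
- by exists (colon rad 1), 1.
exists (colon rad c); split.
- split; [exact: colon_ideal|by rewrite /colon /= mul1r|].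
  move=> a b; rewrite /colon /= => abc.
  have [|ac] := pselect (rad (a * c)); [by left|right].
  apply: (cmax (colon rad (a * c))).
  + by exists (a * c).
  + by move=> z; rewrite /colon /= mulrCA; exact: set_idealMl.
  + by rewrite /colon /= mulrCA mulrA.
- by rewrite /colon /=; apply: set_idealMr => //; exists 1%N, 1; rewrite mulr1.
- move=> b [k [r bck]]; exists k, (c ^+ k), r; split; last by rewrite -exprMn mulrC.
  rewrite /colon /= -exprSr => -[l [s]]; rewrite -exprM => cl; apply: rc.
  by exists (k.+1 * l)%N, s.
Qed.

Section MinimalPrime.
Variables (x : R) (Q : set R).
Hypothesis Qmin : min_prime_over x Q.

Let Qp : set_prime Q. Proof. by case: Qmin. Qed.
Let Qi : set_ideal Q. Proof. by case: Qp. Qed.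

Lemma min_prime_eq P : set_prime P -> P x -> P `<=` Q -> Q `<=` P.
Proof.
move=> Pp Px PQ b Qb; have [_ _ /(_ b Qb)[k [u [r [Qu ub]]]]] := Qmin.
have [Pi _ Pm] := Pp.
have : P (u * b ^+ k) by rewrite ub; exact: set_idealMr.
by case/Pm => [/PQ|/(set_primeX Pp)].
Qed.

(** For an ideal [J]: being the contraction of an ideal of the localisation at [Q]. *)
Definition saturated J := forall u z, ~ Q u -> J (u * z) -> J z.

Definition saturation J : set R := [set z | exists2 u, ~ Q u & J (u * z)].

Lemma saturation_ideal J : set_ideal J -> set_ideal (saturation J).
Proof.
move=> Ji; split.
- by exists 1; [case: Qp|rewrite mulr0; case: Ji].
- move=> y z [u Qu Jy] [w Qw Jz]; exists (u * w); first exact: set_primeNM.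
  have -> : u * w * (y + z) = w * (u * y) + u * (w * z) by ring.
  by apply: set_idealD => //; exact: set_idealMl.
- by move=> a y [u Qu Jy]; exists u => //; rewrite mulrCA; exact: set_idealMl.
Qed.

Lemma saturation_saturated J : saturated (saturation J).
Proof.
move=> u z Qu [w Qw Jz]; exists (w * u); first exact: set_primeNM.
by rewrite -mulrA.
Qed.

Lemma sub_saturation J : J `<=` saturation J.
Proof. by move=> z Jz; exists 1; [case: Qp|rewrite mul1r]. Qed.

Lemma saturated_colon J a : saturated J -> saturated (colon J a).
Proof. by move=> Js u z Qu; rewrite /colon /= -mulrA; exact: Js. Qed.

Definition stabilizes (J : nat -> set R) :=
  exists l, forall n, (l <= n)%N -> J l `<=` J n.

Definition saturated_chain K (J : nat -> set R) :=
  [/\ forall n, set_ideal (J n), forall n, saturated (J n),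
      forall n, J n.+1 `<=` J n & forall n, K `<=` J n].

(* The local ring at [Q] modulo [x] is Artinian; a maximal counterexample [K] *)
(* would be prime, hence equal to [Q].                                        *)
Lemma saturated_chain_stabilizes K (J : nat -> set R) :
  set_ideal K -> K x -> saturated_chain K J -> stabilizes J.
Proof.
move=> Ki Kx KJ.
pose Phi I := [/\ set_ideal I, I x & exists2 J', saturated_chain I J' & ~ stabilizes J'].
apply: contrapT => nJ; have [||K' [[{}Ki {}Kx [{KJ nJ}J KJ nJ]] Kmax]] := @noeth_max Phi.
- by move=> I [].
- by exists K; split=> //; exists J.
have stab I (J' : nat -> set R) : set_ideal I -> K' `<=` I -> ~ (I `<=` K') ->
    saturated_chain I J' ->    stabilizes J'.
  move=> Ii KI IK IJ; apply: contrapT => nJ'; apply: IK; apply: (Kmax) => //.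
  by split=> //; [exact: KI|exists J'].
case: KJ => Ji Js JS KJ; apply: nJ.
have JT n u : ~ Q u -> J n u -> J n = setT.
  move=> Qu Jnu; apply/seteqP; split=> // z _; apply: (Js n u) => //.
  exact: set_idealMr.
have [[u K'u Qu]|KQ] := pselect (exists2 u, K' u & ~ Q u).
  by exists 0%N => n _; rewrite (JT n u Qu) //; exact: KJ.
have {}KQ : K' `<=` Q by move=> u K'u; apply: contrapT => Qu; apply: KQ; exists u.
have [Kp|Kp] := pselect (set_prime K').
  have QK := min_prime_eq Kp Kx KQ.
  have [[n JnQ]|JnQ] := pselect (exists n, J n `<=` Q).
    by exists n => m _; apply: subset_trans JnQ _; exact: subset_trans QK _.
  exists 0%N => n _; have [u Jnu Qu] : exists2 u, J n u & ~ Q u.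
    apply: contrapT => nu; apply: JnQ; exists n => u Jnu.
    by apply: contrapT => Qu; apply: nu; exists u.
  by rewrite (JT n u).
have [a [b [Ka Kb Kab]]] : exists a b, [/\ ~ K' a, ~ K' b & K' (a * b)].
  apply: contrapT => nab; apply: Kp; split=> //.
    by move=> /KQ; case: Qp.
  move=> a b Kab; apply: contrapT => /not_orP[Ka Kb]; apply: nab.
  by exists a, b.
(* The chain stabilises once its sums with [a] and its colons by [a] do. Those two chains contain
   ideals strictly above [K'], so the maximality of [K'] applies to them. *)
have [l1 l1P] : stabilizes (fun n => saturation (ideal_add (J n) a)).
  apply: (stab (ideal_add K' a)).
  - exact: ideal_add_ideal.
  - exact: sub_ideal_add.
  - by move/(_ a (ideal_add_mem _ Ki)).
  - split=> [n|n|n|n].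
    + by apply: saturation_ideal; exact: ideal_add_ideal.
    + exact: saturation_saturated.
    + by move=> z [u Qu [y [r [Jy uz]]]]; exists u => //; exists y, r; split=> //; exact: JS.
    + apply: subset_trans (@sub_saturation _).
      by move=> _ [y [r [Ky ->]]]; exists y, r; split=> //; exact: KJ.
have [l2 l2P] : stabilizes (fun n => colon (J n) a).
  apply: (stab (colon K' a)).
  - exact: colon_ideal.
  - exact: sub_colon.
  - by move=> /(_ b) Kb_; apply/Kb/Kb_; rewrite /colon /= mulrC.
  - split=> [n|n|n|n].
    + exact: colon_ideal.
    + exact: saturated_colon.
    + by move=> z; exact: JS.
    + by move=> z; exact: KJ.
exists (maxn l1 l2) => n; rewrite geq_max => /andP[l1n l2n] z Jz.
have Janti := chain_anti JS.
have Jl1 : J l1 z by apply: Janti Jz; exact: leq_maxl.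
have [u Qu [y [r [Jny uz]]]] : saturation (ideal_add (J n) a) z.
  by apply: l1P => //; apply: sub_saturation; exact: sub_ideal_add.
apply: (Js n u) => //; rewrite uz; apply: set_idealD => //.
apply: (l2P _ l2n); rewrite /colon /=.
have -> : r * a = u * z - y by rewrite uz; ring.
apply: (Janti l2 (maxn l1 l2)); first exact: leq_maxr.
apply: set_idealB => //; first exact: set_idealMl.
by apply: Janti Jny; rewrite geq_max l1n.
Qed.

(* Nakayama's lemma at [Q]: an ideal maximal among the saturated ones between *)
(* [J'] and [J] replaces the determinant trick.                               *)
Lemma saturated_nakayama J J' :
  set_ideal J -> set_ideal J' -> saturated J -> saturated J' -> J' `<=` J ->
  (forall z, J z -> exists u y w, [/\ ~ Q u, J' y, J w & u * z = y + x * w]) ->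
  J `<=` J'.
Proof.
move=> Ji J'i Js J's J'J nak; apply: contrapT => nJJ'.
pose Phi I := [/\ set_ideal I, saturated I, J' `<=` I, I `<=` J & ~ J `<=` I].
have [||I [[Ii Is J'I IJ nJI] Imax]] := @noeth_max Phi.
- by move=> I [].
- by exists J'; split.
have [z Jz Iz] : exists2 z, J z & ~ I z.
  apply: contrapT => nz; apply: nJI => z Jz; apply: contrapT => Iz.
  by apply: nz; exists z.
have JIz : J `<=` saturation (ideal_add I z).
  apply: contrapT => nJ; apply: Iz; apply: (Imax (saturation (ideal_add I z))).
  - split=> //.
    + by apply: saturation_ideal; exact: ideal_add_ideal.
    + exact: saturation_saturated.
    + by move=> y /J'I Iy; apply: sub_saturation; exact: sub_ideal_add.
    + move=> y [u Qu [i [r [Ii' uy]]]]; apply: (Js u) => //; rewrite uy.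
      by apply: set_idealD => //; [exact: IJ|exact: set_idealMl].
  - by move=> y Iy; apply: sub_saturation; exact: sub_ideal_add.
  - by apply: sub_saturation; exact: ideal_add_mem.
have [u [y [w [Qu J'y Jw uz]]]] := nak z Jz.
have [u' Qu' [i [r [Iiz uw]]]] := JIz w Jw.
apply: Iz; apply: (Is (u' * u - x * r)) => [Qd|].
  have : Q (u' * u).
    by rewrite -(subrK (x * r) (u' * u)); apply: set_idealD => //;
       apply: set_idealMr => //; case: Qmin.
  exact: set_primeNM.
have -> : (u' * u - x * r) * z = u' * y + x * i.
  have -> : (u' * u - x * r) * z = u' * (u * z) - x * (r * z) by ring.
  rewrite uz; have -> : r * z = u' * w - i by rewrite uw; ring.
  ring.
by apply: set_idealD => //; apply: set_idealMl => //; exact: J'I.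
Qed.

(* Krull's principal ideal theorem: no nonzero prime is strictly below [Q].   *)
Lemma principal_ideal_thm y : y != 0 ->
  exists k u r, ~ Q u /\ u * x ^+ k = y * r.
Proof.
move=> y0.
(* The contraction of the ideal of [y ^ n] after localising at [Q] and inverting [x]. Once [y ^ l]
   is in [J l.+1], cancelling [y ^ l] shows that [y] divides a power of [x] at [Q]. *)
pose J n : set R := [set z | exists k u r, ~ Q u /\ u * x ^+ k * z = y ^+ n * r].
have Q1 : ~ Q 1 by case: Qp.
have Ji n : set_ideal (J n).
  split.
  - by exists 0%N, 1, 0; rewrite !mulr0.
  - move=> a b [k [u [r [Qu ua]]]] [l [w [s [Qw wb]]]].
    exists (k + l)%N, (u * w), (w * x ^+ l * r + u * x ^+ k * s).
    split; first exact: set_primeNM.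
    have -> : u * w * x ^+ (k + l) * (a + b) =
      w * x ^+ l * (u * x ^+ k * a) + u * x ^+ k * (w * x ^+ l * b).
      by rewrite exprD; ring.
    by rewrite ua wb; ring.
  - move=> a b [k [u [r [Qu ub]]]]; exists k, u, (a * r); split=> //.
    by rewrite mulrCA ub mulrCA.
have Js n : saturated (J n).
  move=> u z Qu [k [w [r [Qw wz]]]]; exists k, (w * u), r.
  by split; [exact: set_primeNM|rewrite -wz; ring].
have Jx n z : J n (x * z) -> J n z.
  by move=> [k [u [r [Qu uz]]]]; exists k.+1, u, r; split=> //; rewrite -uz exprSr; ring.
have JS n : J n.+1 `<=` J n.
  move=> z [k [u [r [Qu uz]]]]; exists k, u, (y * r).
  by split=> //; rewrite uz exprSr mulrA.
have [l lP] : stabilizes (fun n => saturation (ideal_add (J n) x)).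
  apply: (@saturated_chain_stabilizes [set z | exists r, z = r * x]).
  - split; first by exists 0; rewrite mul0r.
    + by move=> _ _ [r ->] [s ->]; exists (r + s); rewrite mulrDl.
    + by move=> a _ [r ->]; exists (a * r); rewrite mulrA.
  - by exists 1; rewrite mul1r.
  - split=> [n|n|n|n].
    + by apply: saturation_ideal; exact: ideal_add_ideal.
    + exact: saturation_saturated.
    + by move=> z [u Qu [a [r [Ja uz]]]]; exists u => //; exists a, r; split=> //; exact: JS.
    + move=> _ [r ->]; apply: sub_saturation; apply: set_idealMl.
        exact: ideal_add_ideal.
      exact: ideal_add_mem.
(* A factor [x] can be cancelled in [J l], so the stability of the sums with [x] makes [J l] equal
   to [J l.+1 + x J l] at [Q], as Nakayama's lemma requires. *)
have /(_ (y ^+ l)) : J l `<=` J l.+1.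
  apply: saturated_nakayama => // z Jz.
  have [u Qu [a [r [Ja uz]]]] : saturation (ideal_add (J l.+1) x) z.
    by apply: (lP l.+1) => //; apply: sub_saturation; exact: sub_ideal_add.
  exists u, a, r; split=> //; last by rewrite uz mulrC [x * r]mulrC addrC mulrC.
  apply: Jx; have -> : x * r = u * z - a by rewrite uz; ring.
  by apply: set_idealB => //; [exact: set_idealMl|exact: JS].
case; first by exists 0%N, 1, 1; split=> //; rewrite !mulr1 mul1r.
move=> k [u [r [Qu uy]]]; exists k, u, r; split=> //.
have yl0 : y ^+ l != 0 by rewrite expf_neq0.
by apply: (mulIf yl0); rewrite uy exprSr; ring.
Qed.

End MinimalPrime.
End Noetherian.

(** * The absolute integral closure *)

Lemma map_polyXnsubC (S T : nzRingType) (f : {rmorphism S -> T}) n x :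
  map_poly f ('X^n - x%:P) = 'X^n - (f x)%:P.
Proof. by rewrite raddfB /= map_polyXn map_polyC. Qed.

Section AbsoluteIntegralClosureTheory.
Variables (R : idomainType) (K : closedFieldType).
Variable phi : {rmorphism {fraction R} -> K}.
Local Notation A := (absint phi).
Local Notation RtoK := (phi \o @tofrac R).
Implicit Types (a b c e w y z : A) (r s u : R).

Fact inclR_subproof r : RtoK r \in absint_pred phi.
Proof. by apply/asboolP; exact: integral_id. Qed.

Definition inclR r : A := Absint (inclR_subproof r).

Fact inclR_is_zmod_morphism : zmod_morphism inclR.
Proof. by move=> r s; apply: val_inj; rewrite /= !rmorphB. Qed.

Fact inclR_is_monoid_morphism : monoid_morphism inclR.
Proof. by split=> [|r s]; apply: val_inj; rewrite /= ?rmorph1 ?rmorphM. Qed.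

HB.instance Definition _ :=
  GRing.isZmodMorphism.Build R A inclR inclR_is_zmod_morphism.
HB.instance Definition _ :=
  GRing.isMonoidMorphism.Build R A inclR inclR_is_monoid_morphism.

Lemma inclR_inj : injective inclR.
Proof. by move=> r s /(congr1 val) /= /fmorph_inj /eqP; rewrite tofrac_eq => /eqP. Qed.

Lemma inclR_eq0 r : (inclR r == 0) = (r == 0).
Proof. by rewrite -(inj_eq inclR_inj) rmorph0. Qed.

Lemma absint_val_eq0 a : (val a == 0) = (a == 0).
Proof. by rewrite -(inj_eq val_inj) rmorph0. Qed.

Lemma absint_mulI a b c : a != 0 -> a * b = a * c -> b = c.
Proof.
move=> a0 /(congr1 val); rewrite !rmorphM => /mulfI eqbc; apply/val_inj/eqbc.
by rewrite absint_val_eq0.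
Qed.

Lemma absint_expI a n b c : a != 0 -> a ^+ n * b = a ^+ n * c -> b = c.
Proof. by move=> a0; elim: n => [|n IHn]; rewrite ?mul1r // exprS -!mulrA => /(absint_mulI a0). Qed.

Lemma absint_integral a :
  exists2 F : {poly R}, F \is monic & (map_poly inclR F).[a] = 0.
Proof.
have /asboolP[F Fm /rootP Fa] := absint_valP a; exists F => //.
apply: val_inj; rewrite rmorph0 -horner_map -map_poly_comp.
exact: Fa.
Qed.

Lemma absint_root (F : {poly A}) (z : K) :
  F \is monic -> root (map_poly val F) z -> exists a, val a = z.
Proof.
move=> Fm Fz.
have zA : z \in absint_pred phi; last by exists (Absint zA).
apply/asboolP; apply: (integral_root_monic (p := map_poly val F)) => //.
  exact: monic_map.
apply/integral_poly => i; rewrite coef_map.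
by apply/asboolP; exact: absint_valP.
Qed.

(** The roots of [F] are roots of the monic [G], hence integral. The constant [c] allows for factors
    [F] whose leading coefficient is not invertible. *)
Lemma absint_split_factor (F G W : {poly A}) c : G \is monic -> c != 0 ->
  c *: G = W * F -> exists rs : seq A, F = lead_coef F *: \prod_(a <- rs) ('X - a%:P).
Proof.
move=> Gm c0 cG; have [zs zsP] := closed_field_poly_normal (map_poly val F).
have [rs rsP] : exists rs : seq A, zs = map val rs.
  have : forall t : K, t \in zs -> exists a, val a = t.
    move=> t tzs; apply: absint_root Gm _.
    have /rootP Ft : root (map_poly val F) t.
      by rewrite zsP /root hornerZ mulf_eq0 [_.[t] == 0]root_prod_XsubC tzs orbT.
    have := congr1 (fun p => (map_poly val p).[t]) cG.
    rewrite rmorphM hornerM Ft mulr0 map_polyZ hornerZ => /eqP.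
    by rewrite mulf_eq0 absint_val_eq0 (negbTE c0).
  elim: zs {zsP} => [|t zs IHzs] zsA; first by exists [::].
  have [|rs ->] := IHzs; first by move=> t' t'zs; apply: zsA; rewrite inE t'zs orbT.
  have [a az] := zsA t (mem_head _ _); exists (a :: rs); rewrite /= az; congr cons.
exists rs; apply: (map_inj_poly val_inj (rmorph0 _)).
rewrite zsP rsP map_polyZ big_map map_prod_XsubC; congr (_ *: _).
rewrite lead_coef_map_inj //; exact: val_inj.
Qed.

Lemma absint_split (F : {poly A}) : F \is monic ->
  exists rs : seq A, F = \prod_(a <- rs) ('X - a%:P).
Proof.
move=> Fm; have [|rs rsP] := @absint_split_factor F F 1 1 Fm (oner_neq0 _).
  by rewrite scale1r mul1r.
by exists rs; rewrite {1}rsP (monicP Fm) scale1r.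
Qed.

Lemma absint_quadratic a b : exists y z, y + z = - a /\ y * z = b.
Proof.
pose F : {poly A} := 'X^2 + (a *: 'X + b%:P).
have szF : (size (a *: 'X + b%:P : {poly A})%R < size ('X^2 : {poly A})%R)%N.
  rewrite size_polyXn; apply: leq_trans (size_polyD _ _) _.
  rewrite geq_max (leq_trans (size_scale_leq _ _)) ?size_polyX //.
  by rewrite (leq_trans (size_polyC_leq1 _)).
have Fm : F \is monic by rewrite monicE lead_coefDl // lead_coefXn.
have [rs rsP] := absint_split Fm.
have : size rs = 2%N.
  have := congr1 (fun p : {poly A} => size p) rsP.
  by rewrite size_prod_XsubC size_polyDl // size_polyXn => -[].
case: rs rsP => [|y [|z []]] //= rsP _; exists y, z.
have {}rsP : F = 'X^2 - (y + z) *: 'X + (y * z)%:P.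
  by rewrite rsP !big_cons big_nil mulr1 -mul_polyC polyCD polyCM; ring.
split.
  have /eqP := congr1 (fun p : {poly A} => p`_1) rsP.
  rewrite /F !(coefD, coefN, coefZ, coefXn, coefX, coefC) /= !mulr1 !addr0 !add0r.
  by move=> /eqP ->; rewrite opprK.
have := congr1 (fun p : {poly A} => p`_0) rsP.
rewrite /F !(coefD, coefN, coefZ, coefXn, coefX, coefC) /=.
by rewrite !mulr0 oppr0 !add0r => ->.
Qed.

Lemma absint_divX a c w n : c != 0 -> (0 < n)%N -> a ^+ n = c ^+ n * w ->
  exists y, a = c * y.
Proof.
move=> c0 n0 acw.
have vc0 : val c != 0 by rewrite absint_val_eq0.
have [||y yE] := @absint_root ('X^n - w%:P) (val a / val c).
- by rewrite monicXnsubC.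
- rewrite map_polyXnsubC rootE !hornerE.
  by rewrite expr_div_n -rmorphXn acw rmorphM rmorphXn mulrAC divff ?mul1r ?subrr // expf_neq0.
exists y; apply: val_inj; rewrite rmorphM /= yE mulrC divfK //.
Qed.

End AbsoluteIntegralClosureTheory.

(** * Primes of the absolute integral closure over a minimal prime *)

Section PrimesOver.
Variables (R : idomainType) (K : closedFieldType).
Variable phi : {rmorphism {fraction R} -> K}.
Local Notation A := (absint phi).
Local Notation inclR := (inclR phi).
Implicit Types (a b c e y z : A) (r s u w x : R) (P Q : set R) (q : set A).

(* Homogenise the integral equation of [b] and evaluate it at [u] instead of  *)
(* at its root [x b].                                                         *)
Lemma integral_norm x b : exists d, forall u, exists r c,
  inclR (u ^+ d + x * r) = (inclR u - inclR x * b) * c.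
Proof.
have [F Fm Fb] := absint_integral b; exists (size F).-1 => u.
set d := (size F).-1.
have sF : size F = d.+1 by rewrite prednK // size_poly_gt0 monic_neq0.
have Fd : F`_d = 1 by exact/eqP.
have dvd i : exists c, inclR u ^+ i - (inclR x * b) ^+ i = (inclR u - inclR x * b) * c.
  by rewrite subrXX; eexists.
have [c cP] := choice dvd.
exists (\sum_(i < d) F`_i * x ^+ (d - i).-1 * u ^+ i).
exists (\sum_(i < d.+1) inclR (F`_i * x ^+ (d - i)) * c i).
have Hu : u ^+ d + x * (\sum_(i < d) F`_i * x ^+ (d - i).-1 * u ^+ i) =
    \sum_(i < d.+1) F`_i * x ^+ (d - i) * u ^+ i.
  rewrite big_ord_recr /= subnn Fd expr0 !mul1r addrC; congr (_ + _).
  rewrite mulr_sumr; apply: eq_bigr => i _.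
  by rewrite -[in RHS](@prednK (d - i)) ?subn_gt0 // exprS; ring.
have Hb : \sum_(i < d.+1) inclR (F`_i * x ^+ (d - i)) * (inclR x * b) ^+ i = 0.
  transitivity (inclR x ^+ d * (map_poly inclR F).[b]); last by rewrite Fb mulr0.
  rewrite horner_coef size_map_inj_poly ?rmorph0 //; last exact: inclR_inj.
  rewrite sF mulr_sumr; apply: eq_bigr => i _.
  rewrite coef_map rmorphM rmorphXn exprMn.
  have -> : inclR x ^+ d = inclR x ^+ (d - i) * inclR x ^+ i.
    by rewrite -exprD subnK // -ltnS.
  by rewrite /=; ring.
rewrite Hu rmorph_sum -[LHS]subr0 -[X in _ - X = _]Hb -sumrB mulr_sumr.
by apply: eq_bigr => i _; rewrite rmorphM rmorphXn -mulrBr cP mulrCA.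
Qed.

Definition lies_over P q := set_prime q /\ forall r, q (inclR r) <-> P r.

Lemma contraction_prime q : set_prime q -> set_prime (inclR @^-1` q).
Proof.
move=> [qi q1 qm]; split; rewrite /preimage /=.
- split=> [|r s qr qs|a r qr]; rewrite /= ?rmorph0 ?rmorphD ?rmorphM.
  + by case: qi.
  + exact: set_idealD.
  + exact: set_idealMl.
- by rewrite rmorph1.
- by move=> r s; rewrite rmorphM; exact: qm.
Qed.

(** A prime containing [I] and disjoint from the image of the complement of [P] contracts into [P],
    and onto [P] because [P] is minimal over [x]. *)
Lemma exists_lies_over x P (I : set A) : min_prime_over x P -> set_ideal I ->
  I (inclR x) -> (forall r, I (inclR r) -> P r) -> exists2 q, lies_over P q & I `<=` q.
Proof.
move=> Pmin Ii Ix IP; have [Pp _ _] := Pmin.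
have [|||q [qp Iq qP _]] :=
    @exists_prime_disjoint _ I [set z | exists2 r, ~ P r & z = inclR r] Ii.
- by exists 1; [case: Pp|rewrite rmorph1].
- move=> _ _ [r Pr ->] [s Ps ->]; exists (r * s); last by rewrite rmorphM.
  exact: set_primeNM.
- by rewrite -subset0 => z [Iz [r Pr zr]]; apply/Pr/IP; rewrite -zr.
have qsub r : q (inclR r) -> P r.
  by move=> qr; apply: contrapT => Pr; move: qP; rewrite -subset0; apply; split;
    [exact: qr|exists r].
exists q => //; split=> // r; split; first exact: qsub.
exact: (min_prime_eq Pmin (contraction_prime qp) (Iq _ Ix)).
Qed.

(** The ideal of [y] and [x] contracts into [P]: if [u] in [R] equals [y b + x c], then
    [integral_norm] makes some [u ^ d + x r] a multiple of [y], so [u] is in [P]. *)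
Lemma lies_over_mem x P y : min_prime_over x P ->
  (forall r c, inclR r = y * c -> P r) -> exists2 q, lies_over P q & q y.
Proof.
move=> Pmin yP; have [Pp Px _] := Pmin; have [Pi _ _] := Pp.
pose I : set A := [set z | exists b c, z = y * b + inclR x * c].
have Ii : set_ideal I.
  split; first by exists 0, 0; rewrite !mulr0 addr0.
  - by move=> _ _ [b [c ->]] [b' [c' ->]]; exists (b + b'), (c + c'); ring.
  - by move=> a _ [b [c ->]]; exists (a * b), (a * c); ring.
have [||q qP Iq] := exists_lies_over Pmin Ii.
- by exists 0, 1; rewrite mulr0 add0r mulr1.
- move=> u [b [c ub]].
  have [d /(_ u)[r [e]]] := integral_norm x c.
  rewrite ub addrK -mulrA => /yP Pur.
  apply: (set_primeX (n := d)) => //.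
  by rewrite -[_ ^+ _](addrK (x * r)); apply: set_idealB => //; exact: set_idealMr.
exists q => //; apply: Iq; by exists 1, 0; rewrite mulr1 mulr0 addr0.
Qed.

Lemma lies_over_exists x P : min_prime_over x P -> exists q, lies_over P q.
Proof.
move=> Pmin; have [[[P0 _ _] _ _] _ _] := Pmin.
have [r c|q qP _] := @lies_over_mem x P 0 Pmin; last by exists q.
by rewrite mul0r => /eqP; rewrite inclR_eq0 => /eqP ->.
Qed.

Lemma inclR_dvd_min_prime x P r b : min_prime_over x P -> inclR r = inclR x * b -> P r.
Proof.
move=> Pmin rb; have [q [[qi _ _] qP]] := lies_over_exists Pmin.
by apply/qP; rewrite rb; apply: set_idealMr => //; apply/qP; case: Pmin.
Qed.

(** * The Krull-Akizuki theorem *)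

Section KrullAkizuki.
Hypothesis noethR : noetherian R.
Variables (x : R) (Q : set R).
Hypotheses (x0 : x != 0) (Qmin : min_prime_over x Q).

Let Qp : set_prime Q. Proof. by case: Qmin. Qed.
Let ix0 : inclR x != 0. Proof. by rewrite inclR_eq0. Qed.

(** The normalisation of [R], seen inside its absolute integral closure. *)
Definition fractional : set A := [set b | exists s r, s != 0 /\ inclR s * b = inclR r].

Lemma fractional_inclR r : fractional (inclR r).
Proof. by exists 1, r; rewrite oner_eq0 rmorph1 mul1r. Qed.

Lemma fractionalD a b : fractional a -> fractional b -> fractional (a + b).
Proof.
move=> [c [r [c0 ca]]] [d [s [d0 db]]]; exists (c * d), (d * r + c * s).
split; first by rewrite mulf_neq0.
have -> : inclR (c * d) * (a + b) = inclR d * (inclR c * a) + inclR c * (inclR d * b).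
  by rewrite rmorphM; ring.
by rewrite ca db rmorphD !rmorphM.
Qed.

Lemma fractionalM a b : fractional a -> fractional b -> fractional (a * b).
Proof.
move=> [c [r [c0 ca]]] [d [s [d0 db]]]; exists (c * d), (r * s).
split; first by rewrite mulf_neq0.
have -> : inclR (c * d) * (a * b) = (inclR c * a) * (inclR d * b).
  by rewrite rmorphM; ring.
by rewrite ca db rmorphM.
Qed.

(** Let [B] be the normalisation of [R]. At [Q], the ideals of those elements of [R] that lie in
    [x ^ n B + x R] contain [x], hence stabilise at some [l]. This allows the exponent in an
    approximation of [b] to be lowered step by step to [l]. *)
Lemma fractional_approx : exists l, forall b, fractional b -> exists u c r,
  [/\ ~ Q u, fractional c & inclR u * inclR x ^+ l * b = inclR x ^+ l.+1 * c + inclR r].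
Proof.
pose I n : set R := [set r | exists u w b,
  [/\ ~ Q u, fractional b & inclR (u * r) = inclR x ^+ n * b + inclR (x * w)]].
have Q1 : ~ Q 1 by case: Qp.
have f0 : fractional 0 by rewrite -(rmorph0 inclR); exact: fractional_inclR.
have IS n : I n.+1 `<=` I n.
  move=> r [u [w [b [Qu fb ur]]]]; exists u, w, (inclR x * b); split=> //.
    by apply: fractionalM => //; exact: fractional_inclR.
  by rewrite ur exprSr mulrA.
have [l lP] : stabilizes I.
  apply: (@saturated_chain_stabilizes _ noethR x Q Qmin [set z | exists r, z = r * x]).
  - split; first by exists 0; rewrite mul0r.
    + by move=> _ _ [r ->] [s ->]; exists (r + s); rewrite mulrDl.
    + by move=> a _ [r ->]; exists (a * r); rewrite mulrA.
  - by exists 1; rewrite mul1r.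
  split=> [n|n|//|n].
  - split.
    + by exists 1, 0, 0; split=> //; rewrite !mulr0 rmorph0 addr0.
    + move=> r s [u [w [b [Qu fb ur]]]] [u' [w' [b' [Qu' fb' us]]]].
      exists (u * u'), (u' * w + u * w'), (inclR u' * b + inclR u * b'); split.
      * exact: set_primeNM.
      * by apply: fractionalD; apply: fractionalM => //; exact: fractional_inclR.
      * have -> : inclR (u * u' * (r + s)) = inclR u' * inclR (u * r) + inclR u * inclR (u' * s).
          by rewrite !(rmorphM, rmorphD) /=; ring.
        by rewrite ur us !(rmorphM, rmorphD) /=; ring.
    + move=> a r [u [w [b [Qu fb ur]]]]; exists u, (a * w), (inclR a * b); split=> //.
        by apply: fractionalM => //; exact: fractional_inclR.
      by rewrite mulrCA rmorphM /= ur !rmorphM /=; ring.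
  - move=> v r Qv [u [w [b [Qu fb ur]]]]; exists (u * v), w, b; split=> //.
      exact: set_primeNM.
    by rewrite -mulrA.
  - by move=> _ [r ->]; exists 1, r, 0; split=> //; rewrite mulr0 add0r mul1r mulrC.
have Ianti := chain_anti IS.
exists l => b fb.
have down n : (exists u c r,
    [/\ ~ Q u, fractional c & inclR u * inclR x ^+ (n + l) * b =
      inclR x ^+ (n + l).+1 * c + inclR r]) ->
  exists u c r,
    [/\ ~ Q u, fractional c & inclR u * inclR x ^+ l * b = inclR x ^+ l.+1 * c + inclR r].
  elim: n => // n IHn [u [c [r [Qu fc uc]]]]; apply: IHn; set m := (n + l)%N.
  (* By stability [r] is then in [I m.+2]: up to a factor outside [Q] it is a multiple of [x] modulo
     [x ^ m.+2] times the normalisation, and one factor [x] cancels. *)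
  have : I m.+1 r.
    exists 1, 0, (inclR u * b - inclR x * c); split=> //.
      apply: fractionalD; first by apply: fractionalM => //; exact: fractional_inclR.
      rewrite -mulNr -rmorphN; apply: fractionalM => //; exact: fractional_inclR.
    rewrite mul1r mulr0 rmorph0 addr0 mulrBr.
    have -> : inclR x ^+ m.+1 * (inclR u * b) = inclR u * inclR x ^+ m.+1 * b by ring.
    by rewrite uc [in RHS]exprSr; ring.
  move=> /(Ianti l m.+1 (leq_trans (leq_addl n l) (leqnSn m))).
  move=> /(lP m.+2); case; first by rewrite /m -addn2 addnAC leq_addl.
  move=> u' [w [c' [Qu' fc' u'r]]].
  exists (u' * u), (inclR u' * c + c'), w; split.
  - exact: set_primeNM.
  - by apply: fractionalD => //; apply: fractionalM => //; exact: fractional_inclR.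
  apply: (absint_mulI ix0).
  have -> : inclR x * (inclR (u' * u) * inclR x ^+ m * b) =
    inclR u' * (inclR u * inclR x ^+ m.+1 * b).
    by rewrite rmorphM exprS /=; ring.
  by rewrite uc mulrDr -rmorphM /= u'r rmorphM !exprS /=; ring.
(* The exponent to start from: at [Q] the denominator of [b] divides a power of [x]. *)
have [c [r [c0 cb]]] := fb.
have [k [u [s [Qu us]]]] := principal_ideal_thm noethR Qmin c0.
apply: (down k); exists u, 0, (x ^+ l * (s * r)); split=> //.
rewrite mulr0 add0r exprD.
have -> : inclR u * (inclR x ^+ k * inclR x ^+ l) * b = inclR x ^+ l * (inclR (u * x ^+ k) * b).
  by rewrite rmorphM rmorphXn /=; ring.
by rewrite us ![in RHS]rmorphM rmorphXn /= -cb rmorphM /=; ring.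
Qed.

(** The remainders [r i] of the approximations lie in the Noetherian ring [R], so one of them is a
    combination of the earlier ones; [x ^ l] then cancels. *)
Lemma krull_akizuki (y : nat -> A) : (forall i, fractional (y i)) ->
  exists N u a (e : nat -> A), ~ Q u /\
    inclR u * y N = inclR x * a + \sum_(i < N) e i * y i.
Proof.
move=> fy; have [l lP] := fractional_approx.
have [u /choice[c /choice[r ucr]]] := choice (fun i => lP _ (fy i)).
have [N [e rN]] := noeth_sequence noethR r.
exists N, (u N), (c N - \sum_(i < N) inclR (e i) * c i), (fun i => inclR (e i * u i)).
split; first by case: (ucr N).
apply: (absint_expI (n := l) ix0).
have [_ _ uN] := ucr N.
have -> : inclR x ^+ l * (inclR (u N) * y N) = inclR (u N) * inclR x ^+ l * y N by ring.
rewrite uN rN rmorph_sum mulrDr mulrBr mulrBr !mulr_sumr exprSr -mulrA -addrA; congr (_ + _).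
rewrite addrC -sumrB; apply: eq_bigr => i _; rewrite !rmorphM /=.
have [_ _ ui] := ucr i.
have -> : inclR (r i) = inclR (u i) * inclR x ^+ l * y i - inclR x ^+ l.+1 * c i.
  by rewrite ui addrC addKr.
by rewrite exprSr; ring.
Qed.

End KrullAkizuki.
End PrimesOver.

(** * Infinitely many primes over a minimal prime of p *)

Section Conjugates.
Variables (R : idomainType) (K : closedFieldType).
Variable phi : {rmorphism {fraction R} -> K}.
Local Notation A := (absint phi).
Local Notation inclR := (inclR phi).
Implicit Types (a c h z : A) (f g w : {poly R}) (r : R).

Definition ev f a := (map_poly inclR f).[a].

Lemma evM f g a : ev (f * g) a = ev f a * ev g a.
Proof. by rewrite /ev rmorphM hornerM. Qed.

Lemma evD f g a : ev (f + g) a = ev f a + ev g a.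
Proof. by rewrite /ev rmorphD hornerD. Qed.

Lemma evZ r f a : ev (r *: f) a = inclR r * ev f a.
Proof. by rewrite /ev map_polyZ hornerZ. Qed.

(** Over [R] a minimal polynomial need not be monic, so it divides only up to a nonzero constant. *)
Definition min_poly h f :=
  [/\ f != 0, ev f h = 0 &
    forall g, ev g h = 0 -> exists r w, r != 0 /\ r *: g = w * f].

Lemma absint_eq0M a c : a * c = 0 -> a = 0 \/ c = 0.
Proof.
have [->|a0 ac] := eqVneq a 0; first by left.
by right; apply: (absint_mulI a0); rewrite ac mulr0.
Qed.

Lemma exists_min_poly h : exists f, min_poly h f.
Proof.
pose Phi n := `[< exists f, [/\ f != 0, ev f h = 0 & size f = n] >].
have exPhi : exists n, Phi n.
  have [F Fm Fh] := absint_integral h.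
  by exists (size F); apply/asboolP; exists F; rewrite monic_neq0.
have [n /asboolP[f [f0 fh fn]] nmin] := ex_minnP exPhi.
exists f; split=> // g gh; exists (lead_coef f ^+ scalp g f), (g %/ f).
split; first exact: Pdiv.Idomain.lc_expn_scalp_neq0.
rewrite Pdiv.Idomain.divp_eq; suff -> : g %% f = 0 by rewrite addr0.
apply/eqP/contraT => gf0.
have : (n <= size (g %% f)%R)%N.
  apply/nmin/asboolP; exists (g %% f); split=> //.
  have := congr1 (ev^~ h) (Pdiv.Idomain.divp_eq g f).
  by rewrite evZ gh mulr0 evD evM fh mulr0 add0r.
by rewrite -fn leqNgt ltn_modp f0.
Qed.

(** The minimal polynomial [k] of [z] divides [f] and [g] up to constants. Its cofactor in [f] does
    not vanish at [h], or [f] would divide it and [k] would divide a nonzero constant; so [k], and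
    with it [g], vanishes at [h]. *)
Lemma min_poly_conj h f z g : min_poly h f -> ev f z = 0 -> ev g z = 0 -> ev g h = 0.
Proof.
move=> [f0 fh fmin] fz gz; have [k [k0 kz kmin]] := exists_min_poly z.
have [r [w [r0 rf]]] := kmin _ fz; have [s [w' [s0 sg]]] := kmin _ gz.
have : ev w h * ev k h = 0 by rewrite -evM -rf evZ fh mulr0.
case/absint_eq0M => [wh|kh].
  have [t [v [t0 tw]]] := fmin _ wh.
  have /(congr1 (ev^~ z)) : (t * r)%:P = v * k.
    apply: (mulIf f0); rewrite mul_polyC -scalerA rf scalerAl tw; ring.
  rewrite evM kz mulr0 /ev map_polyC hornerC => /eqP.
  by rewrite inclR_eq0 mulf_eq0 (negbTE t0) (negbTE r0).
have : inclR s * ev g h = 0 by rewrite -evZ sg evM kh mulr0.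
by case/absint_eq0M => // /eqP; rewrite inclR_eq0 (negbTE s0).
Qed.

(* If [z] divides [r] with integral quotient, clearing denominators in the    *)
(* equation of [r / z] gives an equation of [z], hence one of [h].            *)
Lemma conj_lies_over x P h f z q : min_prime_over x P -> min_poly h f -> ev f z = 0 ->
  lies_over P q -> q h -> exists2 q', lies_over (phi := phi) P q' & q' z.
Proof.
move=> Pmin fmin fz [qp qP] qh; have [qi _ _] := qp; have [Pp _ _] := Pmin.
apply: (lies_over_mem Pmin) => r c rzc.
have [F Fm Fc] := absint_integral c; set d := (size F).-1.
have sF : size F = d.+1 by rewrite prednK // size_poly_gt0 monic_neq0.
have Fd : F`_d = 1 by exact/eqP.
pose W := \sum_(i < d.+1) (F`_i * r ^+ i) *: 'X^(d - i).
have evW a : ev W a = \sum_(i < d.+1) inclR (F`_i * r ^+ i) * a ^+ (d - i).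
  rewrite /ev rmorph_sum horner_sum; apply: eq_bigr => i _.
  by rewrite /= map_polyZ map_polyXn hornerZ hornerXn.
have Wz : ev W z = 0.
  rewrite evW; transitivity (z ^+ d * (map_poly inclR F).[c]); last by rewrite Fc mulr0.
  rewrite horner_coef size_map_inj_poly ?rmorph0 //; last exact: inclR_inj.
  rewrite sF mulr_sumr; apply: eq_bigr => i _.
  rewrite coef_map rmorphM rmorphXn /= rzc exprMn.
  have -> : z ^+ d = z ^+ (d - i) * z ^+ i by rewrite -exprD subnK // -ltnS.
  ring.
have := min_poly_conj fmin fz Wz.
rewrite evW big_ord_recr /= subnn Fd mul1r expr0 mulr1 rmorphXn /= => Wh.
apply/qP; apply: (set_primeX (n := d) qp).
apply: (set_ideal_addl (x := \sum_(i < d) inclR (F`_i * r ^+ i) * h ^+ (d - i)) qi).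
  apply: set_ideal_sum => // i _; apply: set_idealMl => //; apply: set_idealX => //.
  by rewrite subn_gt0.
by rewrite Wh; case: qi.
Qed.

End Conjugates.

(** * Polynomials with exactly one root in each prime over [P] *)

Section Coins.
Variables (R : idomainType) (K : closedFieldType).
Variable phi : {rmorphism {fraction R} -> K}.
Local Notation A := (absint phi).
Local Notation inclR := (inclR phi).
Variables (t x b : R) (P : set R).
Hypotheses (Pmin : min_prime_over t P) (Px : ~ P x) (Pb : P b).
Implicit Types (a c e y z : A) (q : set A) (V : set (set A)) (d k m n : nat).

Let Pp : set_prime P. Proof. by case: Pmin. Qed.
Let Pi : set_ideal P. Proof. by case: Pp. Qed.

(* Modulo a prime over [P] this is [T (T ^ (d + 1) + x)], with a simple root  *)
(* at [0]; modulo a prime above [x] it is [T ^ (d + 2)], totally ramified.     *)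
Definition coin d a := a ^+ d.+2 + inclR x * a + inclR (x * b) = 0.

Definition coin_poly d : {poly R} := 'X^(d.+2) + (x *: 'X + (x * b)%:P).

Lemma ev_coin_poly d a : ev (coin_poly d) a = a ^+ d.+2 + inclR x * a + inclR (x * b).
Proof.
rewrite /ev /coin_poly !rmorphD /= map_polyXn map_polyZ map_polyX map_polyC.
by rewrite !hornerE.
Qed.

Lemma coin_poly_monic d : coin_poly d \is monic.
Proof.
rewrite monicE lead_coefDl ?lead_coefXn // size_polyXn.
apply: leq_ltn_trans (size_polyD _ _) _.
rewrite gtn_max (leq_ltn_trans (size_scale_leq _ _)) ?size_polyX //.
by rewrite (leq_ltn_trans (size_polyC_leq1 _)).
Qed.

Lemma coin_roots d : exists rs : seq A, map_poly inclR (coin_poly d) = \prod_(a <- rs) ('X - a%:P).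
Proof. by apply: absint_split; exact: monic_map (coin_poly_monic d). Qed.

Lemma coin_mem_roots d rs a : map_poly inclR (coin_poly d) = \prod_(a <- rs) ('X - a%:P) ->
  coin d a -> a \in rs.
Proof.
move=> rsP; rewrite /coin -ev_coin_poly /ev rsP horner_prod => /eqP.
elim: {rsP} rs => [|z rs IHrs]; first by rewrite big_nil oner_eq0.
rewrite big_cons hornerXsubC inE => /eqP/absint_eq0M[/eqP|/eqP/IHrs ->].
  by rewrite subr_eq0 => ->.
by rewrite orbT.
Qed.

Lemma mem_roots_coin d rs a : map_poly inclR (coin_poly d) = \prod_(a <- rs) ('X - a%:P) ->
  a \in rs -> coin d a.
Proof.
move=> rsP ars; rewrite /coin -ev_coin_poly /ev rsP horner_prod.
by rewrite (big_rem _ ars) /= hornerXsubC subrr mul0r.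
Qed.

Lemma lies_over_coin d q : lies_over P q -> exists a, coin d a /\ q a.
Proof.
move=> [qp qP]; have [qi _ _] := qp; have [rs rsP] := coin_roots d.
have : ev (coin_poly d) 0 = inclR (x * b).
  by rewrite ev_coin_poly expr0n mulr0 !add0r.
rewrite /ev rsP horner_prod => prodE.
have qxb : q (inclR (x * b)) by apply/qP; exact: set_idealMl.
move: qxb; rewrite -prodE => /(set_prime_prod qp)[k [krs /(_ 0)]].
rewrite hornerXsubC sub0r => /(set_idealN qi); rewrite opprK => qrs.
by exists rs`_k; split=> //; apply: mem_roots_coin rsP (mem_nth 0 krs).
Qed.

(** Subtract the two equations and cancel [a - c]: a sum of terms in [q], plus [x], is zero. *)
Lemma coin_unique d q a c : lies_over P q -> coin d a -> coin d c -> q a -> q c -> a = c.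
Proof.
move=> [[qi _ _] qP] ca cc qa qc; apply/eqP/contraT; rewrite -subr_eq0 => ac0.
have qsum : q (\sum_(i < d.+2) a ^+ (d.+2.-1 - i) * c ^+ i).
  apply: set_ideal_sum => // i _; case: (i : nat) => [|j].
    by apply: set_idealMr => //; exact: set_idealX.
  by apply: set_idealMl => //; exact: set_idealX.
case: Px; apply/qP; apply: (set_ideal_addl qi qsum).
suff -> : \sum_(i < d.+2) a ^+ (d.+2.-1 - i) * c ^+ i + inclR x = 0 by case: qi.
apply: (absint_mulI ac0); rewrite mulr0 mulrDr -subrXX.
have -> : a ^+ d.+2 - c ^+ d.+2 + (a - c) * inclR x =
  (a ^+ d.+2 + inclR x * a + inclR (x * b)) - (c ^+ d.+2 + inclR x * c + inclR (x * b)).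
  by ring.
by rewrite ca cc subrr.
Qed.

(* [V] meets only finitely many classes of primes, two primes being equivalent *)
(* when they contain the same roots of every [coin_poly].                      *)
Definition small V := exists n (f : nat -> nat -> A),
  forall q, V q -> exists2 i, (i < n)%N & forall d, coin d (f i d) /\ q (f i d).

Lemma small_setU V W : small V -> small W -> small (V `|` W).
Proof.
move=> [n [f fP]] [m [g gP]].
exists (n + m)%N, (fun i => if (i < n)%N then f i else g (i - n)%N) => q [/fP|/gP][i lti iP].
  by exists i; rewrite ?lti // ltn_addr.
by exists (n + i)%N; rewrite ?ltn_add2l // ltnNge leq_addr addKn.
Qed.

Lemma small_subset V W : V `<=` W -> small W -> small V.
Proof. by move=> VW [n [f fP]]; exists n, f => q /VW /fP. Qed.

(** If no root separated two primes of [V], they would form a single class. For a degree with a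
    separating root, cut [V] according to the root that a prime contains: one of the finitely many
    pieces is not small, and its root is missing from one of the two separated primes. *)
Lemma coin_split V : V `<=` lies_over P -> ~ small V -> exists d a q0,
  [/\ coin d a, V q0, ~ q0 a & ~ small (V `&` [set q | q a])].
Proof.
move=> VP Vbig.
have [d [a [q0 [q1 [ca Vq0 Vq1 q0a q1a]]]]] : exists d a q0 q1,
    [/\ coin d a, V q0, V q1, q0 a & ~ q1 a].
  apply: contrapT => nsep; apply: Vbig.
  have [[q0 Vq0]|nV] := pselect (exists q, V q); last first.
    by exists 0%N, (fun _ _ => 0) => q Vq; case: nV; exists q.
  have [f fP] := choice (fun d => lies_over_coin d (VP _ Vq0)).
  exists 1%N, (fun=> f) => q1 Vq1; exists 0%N => // d; have [cf q0f] := fP d.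
  split=> //; apply: contrapT => q1f; apply: nsep.
  by exists d, (f d), q0, q1.
have [rs rsP] := coin_roots d.
have [c crs cbig] : exists2 c, c \in rs & ~ small (V `&` [set q | q c]).
  apply: contrapT => nc; apply: Vbig.
  have : V `<=` [set q | exists2 c, c \in rs & V q /\ q c].
    move=> q Vq; have [c [cc qc]] := lies_over_coin d (VP _ Vq).
    by exists c => //; exact: coin_mem_roots rsP cc.
  move=> Vsub; apply: (small_subset Vsub) => {Vsub}.
  have : forall c, c \in rs -> small (V `&` [set q | q c]).
    by move=> c crs; apply: contrapT => cbig; apply: nc; exists c.
  elim: (rs) => [_|c l IHl lsmall].
    by exists 0%N, (fun _ _ => 0) => q [].
  apply: (@small_subset _ ((V `&` [set q | q c]) `|` [set q | exists2 c, c \in l & V q /\ q c])).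
    move=> q [e]; rewrite inE => /orP[/eqP ->|el] Vqe; first by left.
    by right; exists e.
  apply: small_setU; first by apply: lsmall; rewrite mem_head.
  by apply: IHl => e el; apply: lsmall; rewrite inE el orbT.
have cc := mem_roots_coin rsP crs.
have [q0c|q0c] := pselect (q0 c); last by exists d, c, q0.
exists d, c, q1; split=> // q1c.
by apply: q1a; rewrite (coin_unique (VP _ Vq0) ca cc q0a q0c).
Qed.

End Coins.

(** * Norms of the roots, and infinitely many classes of primes over [P] *)

Section CoinNorm.
Variables (R : idomainType) (K : closedFieldType).
Variable phi : {rmorphism {fraction R} -> K}.
Local Notation A := (absint phi).
Local Notation inclR := (inclR phi).
Hypothesis noethR : noetherian R.
Variables (t x b : R) (P Q : set R).
Hypotheses (Pmin : min_prime_over t P) (Qmin : min_prime_over x Q).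
Hypotheses (Px : ~ P x) (Pb : P b) (Qb : ~ Q b).
Implicit Types (a c e y z : A) (q : set A) (d k m n : nat).

Let Pp : set_prime P. Proof. by case: Pmin. Qed.
Let Pi : set_ideal P. Proof. by case: Pp. Qed.
Let x0 : x != 0. Proof. by apply: contra_notN Px => /eqP ->; case: Pi. Qed.
Let Qx : Q x. Proof. by case: Qmin. Qed.

Local Notation coin := (coin (phi := phi) x b).
Local Notation coin_poly := (coin_poly x b).
Local Notation fractional := (fractional (phi := phi)).

Lemma not_uniq_rem (T : eqType) (s : seq T) : ~~ uniq s ->
  exists2 u, u \in s & u \in rem u s.
Proof.
elim: s => //= u s IHs; rewrite negb_and negbK.
have [us _|us /= /IHs[v vs vr]] := boolP (u \in s).
  by exists u; rewrite ?mem_head // eqxx.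
exists v; first by rewrite inE vs orbT.
have -> : (u == v) = false by apply: contraNF us => /eqP ->.
by rewrite inE vr orbT.
Qed.

(** The derivative [(d + 2) z ^ (d + 1) + x] would vanish, which puts [x] in [q]. *)
Lemma coin_double_root d z (S W : {poly A}) c q : c != 0 ->
  lies_over P q -> q z ->
  c *: map_poly inclR (coin_poly d) = W * (('X - z%:P) * (('X - z%:P) * S)) -> False.
Proof.
move=> c0 [[qi _ _] qP] qz /(congr1 (fun p => (deriv p).[z])).
rewrite derivZ hornerZ derivM hornerD !hornerM hornerXsubC subrr !mul0r mulr0 add0r.
rewrite derivM hornerD !hornerM hornerXsubC subrr !mul0r mulr0 addr0 mulr0.
case/absint_eq0M => [/eqP|]; first by rewrite (negbTE c0).
rewrite deriv_map /coin_poly !derivD derivXn derivZ derivX derivC addr0 rmorphD /=.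
rewrite rmorphMn /= map_polyXn map_polyZ rmorph1 hornerD hornerMn hornerXn hornerZ hornerC mulr1.
move=> zx; apply: Px; apply/qP.
apply: (set_ideal_addl (x := z ^+ d.+1 *+ d.+2) qi); last by rewrite zx; case: qi.
by rewrite -mulr_natl; apply: set_idealMl => //; exact: set_idealX.
Qed.

(** Here [y] is the product of the [m] conjugates [z] of a root lying in a prime over [P]. Each
    conjugate lies in such a prime too, so it is one of the [f i d], and none is repeated; hence
    [m <= n]. Multiply the equations [z ^ (d + 2) = - x (z + b)]: each [z] is in [QQ] and [b] is
    not, so [z + b] is outside. *)
Lemma coin_norm n (f : nat -> nat -> A) (QQ : set A) d :
  (forall q, lies_over P q ->
     exists2 i, (i < n)%N & forall k, coin k (f i k) /\ q (f i k)) ->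
  lies_over Q QQ ->
  exists y m e, [/\ fractional y, (0 < m <= n)%N, y ^+ d.+2 = inclR x ^+ m * e & ~ QQ e].
Proof.
move=> fP [QQp QQQ]; have [QQi _ _] := QQp.
have [q qP] := lies_over_exists phi Pmin.
have [h [ch qh]] := lies_over_coin x Pmin Pb d qP.
have [g gmin] := exists_min_poly h; have [g0 gh gdiv] := gmin.
have [r [w [r0 rG]]] : exists r w, r != 0 /\ r *: coin_poly d = w * g.
  by apply: gdiv; rewrite ev_coin_poly.
have rGA : inclR r *: map_poly inclR (coin_poly d) = map_poly inclR w * map_poly inclR g.
  by rewrite -map_polyZ rG rmorphM.
have Gm : map_poly inclR (coin_poly d) \is monic by rewrite monic_map // coin_poly_monic.
have ir0 : inclR r != 0 by rewrite inclR_eq0.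
have [zs] := absint_split_factor Gm ir0 rGA.
rewrite lead_coef_map_inj; [|exact: inclR_inj|exact: rmorph0].
set l := lead_coef g => gzs.
have il0 : inclR l != 0 by rewrite inclR_eq0 lead_coef_eq0.
have zroot z : z \in zs -> ev g z = 0.
  move=> zzs; rewrite /ev gzs hornerZ horner_prod (big_rem z) //= hornerXsubC.
  by rewrite subrr mul0r mulr0.
have zcoin z : z \in zs -> coin d z.
  move=> /zroot gz; rewrite /coin -ev_coin_poly.
  have : inclR r * ev (coin_poly d) z = 0 by rewrite -evZ rG evM gz mulr0.
  by case/absint_eq0M => // /eqP; rewrite (negbTE ir0).
have zhit z : z \in zs -> exists2 q', lies_over P q' & q' z.
  by move=> /zroot gz; exact: conj_lies_over Pmin gmin gz qP qh.
have uzs : uniq zs.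
  apply: contraT => /not_uniq_rem[z zzs zrem].
  have [q' q'P q'z] := zhit z zzs; exfalso.
  apply: (@coin_double_root d z (\prod_(a <- rem z (rem z zs)) ('X - a%:P))
           (inclR l *: map_poly inclR w) (inclR r) q') => //.
  by rewrite rGA gzs (big_rem z) //= (big_rem (r := rem z zs) z) //= -scalerAr -scalerAl.
have mn : (size zs <= n)%N.
  rewrite -(size_mkseq (fun i => f i d) n); apply: uniq_leq_size => // z zzs.
  have [q' q'P q'z] := zhit z zzs; have [i lti /(_ d)[cf q'f]] := fP _ q'P.
  rewrite (coin_unique Px q'P (zcoin z zzs) cf q'z q'f).
  by apply: map_f; rewrite mem_iota.
have m0 : (0 < size zs)%N.
  case: zs gzs {zroot zcoin zhit uzs mn} => // gzs.
  by move: gh => /eqP; rewrite /ev gzs big_nil hornerZ hornerC mulr1 (negbTE il0).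
exists (\prod_(z <- zs) z), (size zs), (\prod_(z <- zs) - (z + inclR b)).
split; last 1 first.
- elim: zs {gzs zroot zhit uzs mn m0} zcoin => [|z zs IHzs] zcoin.
    by rewrite big_nil; case: QQp.
  rewrite big_cons; apply: set_primeNM => //; last first.
    by apply: IHzs => a azs; apply: zcoin; rewrite inE azs orbT.
  move=> /(set_idealN QQi); rewrite opprK => QQzb; apply: Qb; apply/QQQ.
  apply: set_ideal_addl QQzb => //; apply: (set_primeX (n := d.+2) QQp).
  have -> : z ^+ d.+2 = inclR x * - (z + inclR b).
    by rewrite -[LHS]subr0 -(zcoin z (mem_head _ _)) rmorphM /=; ring.
  by apply: set_idealMr => //; apply/QQQ.
- exists ((-1) ^+ size zs * l), g`_0.
  split; first by rewrite mulf_neq0 ?signr_eq0 ?lead_coef_eq0.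
  rewrite rmorphM rmorphXn rmorphN rmorph1 /= -mulrA mulrCA.
  have := congr1 (fun p => p.[0]) gzs; rewrite horner_coef0 coef_map /= => ->.
  rewrite hornerZ horner_prod; congr (_ * _).
  elim: (zs) => [|z s IHs]; first by rewrite !big_nil mulr1.
  by rewrite !big_cons /= -IHs hornerXsubC sub0r exprS; ring.
- by rewrite m0.
- elim: zs {gzs zroot zhit uzs mn m0} zcoin => [|z zs IHzs] zcoin.
    by rewrite !big_nil expr1n mulr1.
  rewrite !big_cons /= exprMn IHzs; last by move=> a azs; apply: zcoin; rewrite inE azs orbT.
  have -> : z ^+ d.+2 = inclR x * - (z + inclR b).
    by rewrite -[LHS]subr0 -(zcoin z (mem_head _ _)) rmorphM /=; ring.
  by rewrite exprS; ring.
Qed.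

(* [a / c] lies in the maximal ideal of the localisation at [q].              *)
Definition small_quotient q c a := exists e z, [/\ ~ q e, q z & e * a = c * z].

(** The [n]-th power of [e a / c] is [e ^ (n - 1) w], so this quotient is integral and lies in
    [q]. *)
Lemma small_quotientX q c a n e w : set_prime q -> c != 0 -> (0 < n)%N ->
  a ^+ n * e = c ^+ n * w -> ~ q e -> q w -> small_quotient q c a.
Proof.
move=> qp c0 n0 acw qe qw; have [qi _ _] := qp.
have eaw : (e * a) ^+ n = c ^+ n * (e ^+ n.-1 * w).
  rewrite exprMn -(prednK n0) exprS /= prednK //.
  have -> : e * e ^+ n.-1 * a ^+ n = e ^+ n.-1 * (a ^+ n * e) by ring.
  by rewrite acw; ring.
have [z eaz] := absint_divX c0 n0 eaw.
exists e, z; split=> //; apply: (set_primeX (n := n) qp).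
have -> : z ^+ n = e ^+ n.-1 * w.
  by apply: (absint_expI (n := n) c0); rewrite -exprMn -eaz eaw.
exact: set_idealMl.
Qed.

Lemma small_quotientD q c a a' : set_prime q ->
  small_quotient q c a -> small_quotient q c a' -> small_quotient q c (a + a').
Proof.
move=> qp [e [z [qe qz ea]]] [e' [z' [qe' qz' ea']]].
have [qi _ _] := qp.
exists (e * e'), (e' * z + e * z'); split.
- exact: set_primeNM.
- by apply: set_idealD => //; exact: set_idealMl.
- have -> : e * e' * (a + a') = e' * (e * a) + e * (e' * a') by ring.
  by rewrite ea ea'; ring.
Qed.

Lemma small_quotientMl q c a a' : set_prime q ->
  small_quotient q c a -> small_quotient q c (a' * a).
Proof.
move=> [qi _ _] [e [z [qe qz ea]]]; exists e, (a' * z); split=> //.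
  exact: set_idealMl.
by rewrite mulrCA ea mulrCA.
Qed.

(* Otherwise the norms [y_d] of the coins to fractional integral elements have *)
(* values [m / d] with [m] bounded at a prime over [Q], so that no [y_d] is    *)
(* generated by [x] and its predecessors, against [krull_akizuki].             *)
Lemma lies_over_not_small : ~ small x b (lies_over (phi := phi) P).
Proof.
move=> [n [f fP]]; have [QQ QQQ] := lies_over_exists phi Qmin.
have [QQp QQR] := QQQ; have [QQi _ _] := QQp.
(* With [m i] between 1 and [n], this growth makes the values [m i / d i] strictly decreasing and
   smaller than 1, the value of [x]. *)
pose d i := (n.+1 ^ i.+2)%N.
have n0 : (0 < n)%N.
  by have [q /fP[i lti _]] := lies_over_exists phi Pmin; exact: leq_ltn_trans lti.
have d2 i : (d i = (d i).-2.+2)%N.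
  have : (1 < d i)%N by rewrite /d (leq_trans _ (ltn_expl _ _)) // ?ltnS.
  by case: (d i) => [|[]].
have := fun i => coin_norm (d i).-2 fP QQQ.
move=> /choice[y /choice[m /choice[e yP]]].
have [|N [u [a [c [Qu uy]]]]] := @krull_akizuki _ _ phi noethR x Q x0 Qmin y.
  by move=> i; case: (yP i).
have yE i : y i ^+ d i = inclR x ^+ m i * e i by rewrite [in LHS]d2; case: (yP i).
have eP i : ~ QQ (e i) by case: (yP i).
have m0 i : (0 < m i)%N by case: (yP i) => _ /andP[].
have mn i : (m i <= n)%N by case: (yP i) => _ /andP[].
have d0 i : (0 < d i)%N by rewrite d2.
have ix0 : inclR x != 0 by rewrite inclR_eq0.
have QQx : QQ (inclR x) by apply/QQR.
have e0 i : e i != 0 by apply/eqP => ei; apply: (eP i); rewrite ei; case: QQi.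
have xe0 k i : inclR x ^+ k * e i != 0.
  apply/eqP => xe; have := e0 i; apply/negP; rewrite negbK; apply/eqP.
  by apply: (absint_expI (n := k) ix0); rewrite xe mulr0.
have y0 : y N != 0.
  apply/eqP => yN; have := xe0 (m N) N; rewrite -yE yN expr0n.
  by rewrite eqn0Ngt d0 eqxx.
have smallx : small_quotient QQ (y N) (inclR x).
  apply: (small_quotientX (n := d N) (e := e N) (w := inclR x ^+ (d N - m N))) => //.
    have mdN : (m N <= d N)%N.
      apply: (leq_trans (mn N)); rewrite /d expnS.
      by rewrite (leq_trans (leqnSn n)) // leq_pmulr // expn_gt0.
    by rewrite yE mulrAC -exprD subnKC.
  apply: set_idealX => //; rewrite subn_gt0; apply: (leq_ltn_trans (mn N)).
  by rewrite /d expnS leq_pmulr // expn_gt0.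
have smally i : (i < N)%N -> small_quotient QQ (y N) (y i).
  move=> ltiN.
  have lt : (m N * d i < m i * d N)%N.
    have dN : (n.+1 * d i <= d N)%N by rewrite /d -expnS leq_pexp2l.
    apply: (@leq_trans (n.+1 * d i)%N).
      by rewrite ltn_pmul2r ?d0 // ltnS.
    by apply: (leq_trans dN); rewrite leq_pmull.
  apply: (small_quotientX (n := (d i * d N)%N) (e := e N ^+ d i)
           (w := inclR x ^+ (m i * d N - m N * d i) * e i ^+ d N)) => //.
  - by rewrite muln_gt0 !d0.
  - rewrite exprM yE [(d i * d N)%N]mulnC [y N ^+ _]exprM yE !exprMn -!exprM.
    have -> : inclR x ^+ (m i * d N) = inclR x ^+ (m N * d i) * inclR x ^+ (m i * d N - m N * d i).
      by rewrite -exprD subnKC // ltnW.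
    by ring.
  - exact: set_primeNX.
  - by apply: set_idealMr => //; apply: set_idealX => //; rewrite subn_gt0.
(* Divided by [y N], the relation puts [u] into the maximal ideal at [QQ], although [u] is outside
   [Q]. *)
have : small_quotient QQ (y N) (inclR u * y N).
  rewrite uy; apply: small_quotientD => //; first by rewrite mulrC; exact: small_quotientMl.
  apply: big_ind => [|z z'|i _].
  - by exists 1, 0; split; [case: QQp|case: QQi|rewrite !mulr0].
  - exact: small_quotientD.
  - by apply: small_quotientMl => //; exact: smally.
case=> e' [z [QQe QQz e'u]].
have /(absint_mulI y0) : y N * (e' * inclR u) = y N * z by rewrite -e'u; ring.
by move=> e'uz; move: QQz; rewrite -e'uz; apply: set_primeNM => // /QQR.
Qed.

End CoinNorm.

(** * The approximating sequence *)

(** Induction on a bound for the size: [F - F.[r 0]] is [G] times [X - r 0], and in the domain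
    [R / P] the remaining [r i] are roots of [G]. *)
Lemma monic_no_roots_mod_prime (R : idomainType) (P : set R) (F : {poly R}) (r : nat -> R) :
  set_prime P -> F \is monic -> (forall i j, (i < j)%N -> ~ P (r j - r i)) ->
  (forall i, P F.[r i]) -> False.
Proof.
move=> Pp; have [Pi P1 Pm] := Pp.
move: {2}(size F) (leqnn (size F)) => n; elim: n F r => [|n IHn] F r.
  by rewrite leqn0 size_poly_eq0 => /eqP -> /monic_neq0; rewrite eqxx.
move=> sF Fm rP FP.
have [F1|F1] := leqP (size F) 1.
  have Fc : F = 1.
    have /size_poly1P[c c0 Fc] : size F == 1%N.
      by rewrite eqn_leq F1 size_poly_gt0 monic_neq0.
    by move: Fm; rewrite Fc monicE lead_coefC => /eqP ->.
  by apply: P1; have := FP 0%N; rewrite Fc hornerC.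
have : root (F - F.[r 0%N]%:P) (r 0%N) by rewrite /root !hornerE subrr.
move=> /factor_theorem[G FG].
have sFc : size (F - F.[r 0%N]%:P) = size F.
  by rewrite size_polyDl // size_polyN (leq_ltn_trans (size_polyC_leq1 _)).
have Gm : G \is monic.
  rewrite -(monicMr G (monicXsubC (r 0%N))) -FG monicE lead_coefDl ?(monicP Fm) //.
  by rewrite size_polyN (leq_ltn_trans (size_polyC_leq1 _)).
apply: (IHn G (fun i => r i.+1)) => // [|i j ij|i].
- move: sF; rewrite -sFc FG size_Mmonic ?monicXsubC ?monic_neq0 // size_XsubC addn2 /=.
  by rewrite ltnS.
- by apply: rP.
- have : P (G.[r i.+1] * (r i.+1 - r 0%N)).
    have := congr1 (fun p => p.[r i.+1]) FG.
    rewrite hornerM hornerXsubC !hornerE => <-; exact: set_idealB.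
  by case/Pm => // /(rP _ _ (ltn0Sn i)).
Qed.

Section Tower.
Variables (R : idomainType) (K : closedFieldType).
Variable phi : {rmorphism {fraction R} -> K}.
Local Notation A := (absint phi).
Local Notation inclR := (inclR phi).
Hypothesis noethR : noetherian R.
Variables (t x b : R) (P Q : set R).
Hypotheses (Pmin : min_prime_over t P) (Qmin : min_prime_over x Q) (t0 : t != 0).
Hypotheses (Px : ~ P x) (Pb : P b) (Qb : ~ Q b).
Hypothesis xunit : forall r, ~ P (1 + x * r).
Implicit Types (a c e y z s u g h : A) (q : set A) (V : set (set A)) (d k m n : nat).

Let Pp : set_prime P. Proof. by case: Pmin. Qed.
Let Pi : set_ideal P. Proof. by case: Pp. Qed.
Let Pt : P t. Proof. by case: Pmin. Qed.
Local Notation tau := (inclR t).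
Let tau0 : tau != 0. Proof. by rewrite inclR_eq0. Qed.
Local Notation small := (small (phi := phi) x b).
Local Notation over := (lies_over (phi := phi) P).

Lemma coin_factor V : V `<=` over -> ~ small V -> exists beta q0 k V',
  [/\ V q0, exists e a, ~ q0 e /\ e * beta = tau ^+ 3 * a,
      V' `<=` V, ~ small V' & (0 < k)%N /\ forall q, V' q -> q (beta - inclR (x ^+ k))].
Proof.
move=> VP Vbig; have [d [a [q0 [ca Vq0 q0a Vabig]]]] := coin_split Pmin Px Pb VP Vbig.
have [_ _ /(_ b Pb)[k0 [u [r [Pu ub]]]]] := Pmin; set k := k0.+1.
have {}ub : u * b ^+ k = t * (r * b) by rewrite exprSr mulrA ub mulrA.
have [q0p q0P] := VP _ Vq0.
(* Since [a (x + a ^ (d + 1)) = - x b] and [a] is outside [q0], the base is a multiple of [b] at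
   [q0], where [t] divides [b ^ k]; in a prime containing [a] it is congruent to [x]. The exponent 3
   leaves a factor [tau] when [tau ^ 2] is taken out of a square in [tower_valuation]. *)
exists ((inclR x + a ^+ d.+1) ^+ (k * 3)), q0, (k * 3)%N, (V `&` [set q | q a]); split=> //.
- exists ((a ^+ k * inclR u) ^+ 3), (inclR ((- x) ^+ k * (r * b)) ^+ 3); split.
    apply: set_primeNX => //; apply: set_primeNM => //; first exact: set_primeNX.
    by move=> /q0P.
  have adual : a * (inclR x + a ^+ d.+1) = inclR (- (x * b)).
    by rewrite mulrDr -exprS rmorphN /= -[RHS]addr0 -ca; ring.
  rewrite exprM -!exprMn; congr (_ ^+ 3).
  rewrite -mulrA mulrCA -exprMn adual -!rmorphXn -!rmorphM /=; congr inclR.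
  by rewrite -mulNr exprMn mulrCA ub mulrCA.
- split=> // q [/VP[[qi _ _] _] qa].
  rewrite rmorphXn subrXX; apply: set_idealMr => //.
  by rewrite addrAC subrr add0r; exact: set_idealX.
Qed.

Definition sign_power r n := r = x ^+ n \/ r = - x ^+ n.

(* [g s = tau ^ (i + 1) u], so [- tau u / s] approximates the root in [q] of   *)
(* [T ^ 2 + s beta T + tau u beta], and adding [tau ^ i] times this root to    *)
(* [g] raises its order by one wherever [beta] is invertible, and keeps it     *)
(* where [beta] is divisible by [tau ^ 3].                                     *)
Definition stage s u r n V :=
  [/\ V `<=` over, ~ small V, sign_power r n &
    forall q, V q -> [/\ ~ q s, ~ q u & q (s - inclR r)]].

Lemma stage_step s u r n V : stage s u r n V -> exists s' u' r' n' V' beta h q0,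
  [/\ stage s' u' r' n' V', (n < n')%N, V' `<=` V, V q0 &
   [/\ exists e a, ~ q0 e /\ e * beta = tau ^+ 3 * a,
       h ^+ 2 = - beta * (s * h + tau * u) &
       forall g i, g * s = tau ^+ i.+1 * u -> (g + tau ^+ i * h) * s' = tau ^+ i.+2 * u']].
Proof.
move=> [VP Vbig rn Vq].
have [beta [q0 [k [V0 [Vq0 betaq0 V0V V0big [k0 V0beta]]]]]] := coin_factor VP Vbig.
have [h1 [h2 [hD hM]]] := absint_quadratic (s * beta) (tau * u * beta).
have V0nb q : V0 q -> ~ q beta.
  move=> V0q qb; have [[qi q1 qm] qP] := VP _ (V0V _ V0q).
  have := set_idealB qi qb (V0beta _ V0q); rewrite opprB addrC subrK => /qP.
  exact: set_primeNX.
(* Exactly one root lies in each prime of [V0]; name [h] one that does so for *)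
(* a set of primes that is not small.                                         *)
have [h [h' [V' [V'0 V'big hq [{}hD {}hM]]]]] : exists h h' V',
    [/\ V' `<=` V0, ~ small V', forall q, V' q -> q h &
      h + h' = - (s * beta) /\ h * h' = tau * u * beta].
  have [V1big|V1small] := pselect (small (V0 `&` [set q | q h1])); last first.
    by exists h1, h2, (V0 `&` [set q | q h1]); split=> // q [].
  exists h2, h1, (V0 `&` [set q | q h2]); split=> [q []||q []|] //; last first.
    by split; [rewrite addrC|rewrite mulrC].
  move=> V2small; apply: V0big.
  apply: small_subset (small_setU V1big V2small) => q V0q.
  have [[qi q1 qm] qP] := VP _ (V0V _ V0q).
  have : q (h1 * h2) by rewrite hM -mulrA; apply: set_idealMr => //; apply/qP.
  by case/qm; [left|right].
have V'V : V' `<=` V by move=> q /V'0 /V0V.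
(* In a prime of [V'], which contains [h], the other root [h'] is congruent to [- s beta], hence to
   [- r x ^ k]; substituting this in [- s h' ^ 2] gives the new [r]. *)
exists (- s * h' ^+ 2), (u ^+ 2 * beta), (- r * (r * x ^+ k) ^+ 2), (3 * n + 2 * k)%N.
exists V', beta, h, q0.
split=> //; last 1 first.
- split=> //.
    have -> : h ^+ 2 = h * (h + h') - h * h' by ring.
    by rewrite hD hM; ring.
  move=> g i gs.
  have -> : (g + tau ^+ i * h) * (- s * h' ^+ 2) =
      - (g * s) * h' ^+ 2 - tau ^+ i * s * h' * (h * h') by ring.
  rewrite gs hM.
  have -> : - (tau ^+ i.+1 * u) * h' ^+ 2 - tau ^+ i * s * h' * (tau * u * beta) =
      - tau ^+ i.+1 * u * h' * (h' - (- (s * beta))) by rewrite !exprS; ring.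
  rewrite -hD opprD addrCA subrr addr0.
  have -> : - tau ^+ i.+1 * u * h' * (- h) = tau ^+ i.+1 * u * (h * h') by ring.
  by rewrite hM !exprS; ring.
- split=> //.
  + by move=> q /V'V /VP.
  + rewrite /sign_power; case: rn => ->; [right|left].
      by rewrite mulnC exprD [(2 * k)%N]mulnC !exprM; ring.
    by rewrite mulnC exprD [(2 * k)%N]mulnC !exprM; ring.
  + move=> q V'q; have [qs qu qsr] := Vq _ (V'V _ V'q).
    have [[qi q1 qm] qP] := VP _ (V'V _ V'q).
    have qh := hq _ V'q; have qb := V0nb _ (V'0 _ V'q).
    have qh' : ~ q h'.
      move=> qh'; have := set_idealD qi qh qh'; rewrite hD => /(set_idealN qi).
      by rewrite opprK => /qm[].
    split.
    * apply: set_primeNM => //; last exact: set_primeNX.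
      by move=> /(set_idealN qi); rewrite opprK.
    * by apply: set_primeNM => //; exact: set_primeNX.
    * have h'E : h' = - (s * beta) - h by rewrite -hD addrC addKr.
      have qh'r : q (h' + inclR (r * x ^+ k)).
        rewrite rmorphM; have -> : h' + inclR r * inclR (x ^+ k) =
          - h - s * (beta - inclR (x ^+ k)) - (s - inclR r) * inclR (x ^+ k).
          by rewrite h'E; ring.
        apply: set_idealB => //; last exact: set_idealMr.
        apply: set_idealB => //; first exact: set_idealN.
        by apply: set_idealMl => //; exact: V0beta (V'0 _ V'q).
      rewrite rmorphM rmorphN rmorphXn /=.
      have -> : - s * h' ^+ 2 - - inclR r * inclR (r * x ^+ k) ^+ 2 =
        (h' + inclR (r * x ^+ k)) * (- s * (h' - inclR (r * x ^+ k)))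
        - (s - inclR r) * inclR (r * x ^+ k) ^+ 2 by ring.
      by apply: set_idealB => //; exact: set_idealMr.
- by rewrite mulSn -addnA -[X in (X < _)%N]addn0 ltn_add2l addn_gt0 !muln_gt0 /= k0 orbT.
Qed.

(** Dependent choice on [stage_step], from [s = u = 1], [g 0 = tau] and all primes over [P]. The
    sets of primes decrease, so [q i] satisfies the congruences of every stage [j <= i]. *)
Lemma exists_tower : exists (g s u beta h : nat -> A) (q : nat -> set A) (r : nat -> R)
    (n : nat -> nat),
  [/\ forall i, g i.+1 = g i + tau ^+ i * h i,
      forall i, g i * s i = tau ^+ i.+1 * u i,
      forall i, h i ^+ 2 = - beta i * (s i * h i + tau * u i),
      forall i, [/\ over (q i), ~ q i (s i), ~ q i (u i) &
        exists e a, ~ q i e /\ e * beta i = tau ^+ 3 * a] &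
      [/\ forall i j, (j <= i)%N -> q i (s j - inclR (r j)),
        forall i, sign_power (r i) (n i) & forall i, (n i < n i.+1)%N]].
Proof.
pose T := {st : A * A * R * nat * set (set A) |
  let: (s, u, r, n, V) := st in stage s u r n V}.
have st0 : stage 1 1 1 0 over.
  split=> //; first exact: (lies_over_not_small noethR Pmin Qmin Px Pb Qb).
    by left; rewrite expr0.
  by move=> q [[[q0 _ _] q1 _] _]; rewrite rmorph1 subrr.
pose s_ (st : T) := let: (s, _, _, _, _) := sval st in s.
pose u_ (st : T) := let: (_, u, _, _, _) := sval st in u.
pose r_ (st : T) := let: (_, _, r, _, _) := sval st in r.
pose n_ (st : T) := let: (_, _, _, n, _) := sval st in n.
pose V_ (st : T) := let: (_, _, _, _, V) := sval st in V.
have stP st : stage (s_ st) (u_ st) (r_ st) (n_ st) (V_ st).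
  by case: st => [[[[[s u] r] n] V]].
have step (st : T) : exists d : T * A * A * set A, let: (st', beta, h, q0) := d in
  [/\ (n_ st < n_ st')%N, V_ st' `<=` V_ st, V_ st q0 &
   [/\ exists e a, ~ q0 e /\ e * beta = tau ^+ 3 * a,
       h ^+ 2 = - beta * (s_ st * h + tau * u_ st) &
       forall g i, g * s_ st = tau ^+ i.+1 * u_ st ->
         (g + tau ^+ i * h) * s_ st' = tau ^+ i.+2 * u_ st']].
  have [s' [u' [r' [n' [V' [beta [h [q0 [st'P ? ? ? ?]]]]]]]]] := stage_step (stP st).
  by exists (exist _ (s', u', r', n', V') st'P, beta, h, q0).
have [f fP] := choice step.
pose st i := iter i (fun st => (f st).1.1.1) (exist _ (1, 1, 1, 0%N, over) st0).
pose beta i := (f (st i)).1.1.2; pose h i := (f (st i)).1.2; pose q i := (f (st i)).2.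
pose g i := tau + \sum_(k < i) tau ^+ k * h k.
have stS i : [/\ (n_ (st i) < n_ (st i.+1))%N, V_ (st i.+1) `<=` V_ (st i), V_ (st i) (q i) &
   [/\ exists e a, ~ q i e /\ e * beta i = tau ^+ 3 * a,
       h i ^+ 2 = - beta i * (s_ (st i) * h i + tau * u_ (st i)) &
       forall g k, g * s_ (st i) = tau ^+ k.+1 * u_ (st i) ->
         (g + tau ^+ k * h i) * s_ (st i.+1) = tau ^+ k.+2 * u_ (st i.+1)]].
  have := fP (st i); rewrite /beta /h /q /=.
  by case: (f (st i)) => [[[st' beta'] h'] q'].
have gS i : g i.+1 = g i + tau ^+ i * h i by rewrite /g big_ord_recr /= addrA.
exists g, (fun i => s_ (st i)), (fun i => u_ (st i)), beta, h, q, (fun i => r_ (st i)),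
  (fun i => n_ (st i)); split=> //.
- elim=> [|i IHi]; first by rewrite /g big_ord0 addr0 expr1.
  by have [_ _ _ [_ _ IH]] := stS i; rewrite gS; exact: IH.
- by move=> i; have [_ _ _ []] := stS i.
- move=> i; have [_ _ Vq [ea _ _]] := stS i; have [VP _ _ /(_ _ Vq)[? ? ?]] := stP (st i).
  by split=> //; exact: VP.
split=> [i j ji|i|i].
- have [_ _ Vq _] := stS i; have [_ _ _ VjP] := stP (st j).
  have Vji : V_ (st i) `<=` V_ (st j).
    by apply: (@chain_anti _ (fun k => V_ (st k))) => // k; have [] := stS k.
  by have [] := VjP _ (Vji _ Vq).
- by have [] := stP (st i).
- by have [] := stS i.
Qed.

(** The exponents increase strictly, so the difference is, up to sign, [x ^ (n i.+1)] times some
    [1 + x w]. *)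
Lemma sign_power_sum (r : nat -> R) (n : nat -> nat) i j :
  (forall i, sign_power (r i) (n i)) -> (forall i, (n i < n i.+1)%N) -> (i < j)%N ->
  ~ P (\sum_(k < j.+1) r k - \sum_(k < i.+1) r k).
Proof.
move=> rn nS ij.
have n_le k : (k + n i.+1 <= n (k + i.+1))%N.
  by elim: k => // k IHk; apply: leq_trans (nS _); rewrite ltnS.
have rdvd k : exists w, r (k.+1 + i.+1)%N = x ^+ (n i.+1).+1 * w.
  have le := leq_trans (leq_add2r (n i.+1) 1 k.+1) (n_le k.+1).
  have [->|->] := rn (k.+1 + i.+1)%N.
    by exists (x ^+ (n (k.+1 + i.+1) - (n i.+1).+1)); rewrite -exprD subnKC.
  by exists (- x ^+ (n (k.+1 + i.+1) - (n i.+1).+1)); rewrite mulrN -exprD subnKC.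
have [w wP] := choice rdvd.
have -> : \sum_(k < j.+1) r k - \sum_(k < i.+1) r k =
    r i.+1 + x ^+ (n i.+1).+1 * \sum_(k < j - i.+1) w k.
  have -> : j.+1 = (i.+1 + (j - i.+1).+1)%N by rewrite addnS subnKC.
  rewrite big_split_ord /= addrAC subrr add0r big_ord_recl /= addn0 mulr_sumr.
  by congr (_ + _); apply: eq_bigr => k _; rewrite -wP /= addnC.
have Pxn : ~ P (x ^+ n i.+1) by exact: set_primeNX.
have [->|->] := rn i.+1.
  have -> : x ^+ n i.+1 + x ^+ (n i.+1).+1 * \sum_(k < j - i.+1) w k =
    x ^+ n i.+1 * (1 + x * \sum_(k < j - i.+1) w k) by rewrite exprS; ring.
  exact: set_primeNM.
have -> : - x ^+ n i.+1 + x ^+ (n i.+1).+1 * \sum_(k < j - i.+1) w k =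
  - (x ^+ n i.+1 * (1 + x * - \sum_(k < j - i.+1) w k)) by rewrite exprS; ring.
by move=> /(set_idealN Pi); rewrite opprK; exact: set_primeNM.
Qed.

Lemma integrally_closed_sqr c a y e q : set_prime q -> c != 0 -> q y ->
  (e * a) ^+ 2 = c ^+ 2 * y -> exists2 z, q z & e * a = c * z.
Proof.
move=> qp c0 qy eay; have [z eaz] := absint_divX c0 (ltn0Sn 1) eay.
exists z => //; apply: (set_primeX (n := 2) qp).
suff -> : z ^+ 2 = y by [].
by apply: (absint_expI (n := 2) c0); rewrite -exprMn -eaz.
Qed.

Section Contradiction.
Variables (g s u beta h : nat -> A) (q : nat -> set A) (r : nat -> R) (n : nat -> nat).
Hypotheses (gS : forall i, g i.+1 = g i + tau ^+ i * h i)
  (gs : forall i, g i * s i = tau ^+ i.+1 * u i)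
  (hh : forall i, h i ^+ 2 = - beta i * (s i * h i + tau * u i))
  (qP : forall i, [/\ over (q i), ~ q i (s i), ~ q i (u i) &
        exists e a, ~ q i e /\ e * beta i = tau ^+ 3 * a])
  (qs : forall i j, (j <= i)%N -> q i (s j - inclR (r j)))
  (rn : forall i, sign_power (r i) (n i)) (nS : forall i, (n i < n i.+1)%N).

(* In the local ring at [q i], the quotient [g m / tau ^ (i + 1)] is a unit   *)
(* for [m > i].                                                               *)
Lemma tower_valuation i k : exists e w,
  [/\ ~ q i e, ~ q i w, e * g (k + i.+1)%N = tau ^+ i.+1 * w & q i (s (k + i.+1)%N)].
Proof.
have [[qp qR] qis qiu [e0 [a [qe0 e0b]]]] := qP i; have [qi _ _] := qp.
have qt : q i tau by apply/qR.
have q_s m w e k' : ~ q i w -> e * g m = tau ^+ i.+1 * w -> (m = k' + i.+1)%N -> q i (s m).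
  move=> qw egm mk; have : w * s m = tau ^+ k'.+1 * (e * u m).
    apply: (absint_expI (n := i.+1) tau0).
    have -> : tau ^+ i.+1 * (w * s m) = e * (g m * s m) by rewrite mulrA -egm mulrA.
    by rewrite gs mk -addSn exprD; ring.
  have [_ _ qm] := qp; move=> wsm.
  have : q i (w * s m) by rewrite wsm; apply: set_idealMr => //; exact: set_idealX.
  by case/qm.
elim: k => [|k [e [w [qe qw egk qsk]]]].
  have [y qy e0h] : exists2 y, q i y & e0 * h i = tau * y.
    apply: (@integrally_closed_sqr tau (h i) (tau * (- e0 * a * (s i * h i + tau * u i)))) => //.
      exact: set_idealMr.
    rewrite exprMn hh.
    have -> : e0 ^+ 2 * (- beta i * (s i * h i + tau * u i)) =
      - e0 * (e0 * beta i) * (s i * h i + tau * u i) by ring.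
    by rewrite e0b; ring.
  have qw : ~ q i (e0 * u i + s i * y).
    rewrite addrC => /(set_ideal_addl qi (set_idealMl (s i) qi qy)).
    exact: set_primeNM.
  have egw : e0 * s i * g i.+1 = tau ^+ i.+1 * (e0 * u i + s i * y).
    rewrite gS mulrDr.
    have -> : e0 * s i * g i = e0 * (g i * s i) by ring.
    have -> : e0 * s i * (tau ^+ i * h i) = s i * tau ^+ i * (e0 * h i) by ring.
    by rewrite gs e0h exprS; ring.
  exists (e0 * s i), (e0 * u i + s i * y); split=> //; first exact: set_primeNM.
  exact: (q_s i.+1 _ _ 0%N qw egw).
have qh : q i (h (k + i.+1)%N).
  apply: (set_primeX (n := 2) qp); rewrite hh; apply: set_idealMl => //.
  by apply: set_idealD => //; exact: set_idealMr.
have qw' : ~ q i (w + tau ^+ k * (e * h (k + i.+1)%N)).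
  have qth : q i (tau ^+ k * (e * h (k + i.+1)%N)).
    by apply: set_idealMl => //; exact: set_idealMl.
  by rewrite addrC => /(set_ideal_addl qi qth).
have egw : e * g (k.+1 + i.+1)%N = tau ^+ i.+1 * (w + tau ^+ k * (e * h (k + i.+1)%N)).
  by rewrite addSn gS mulrDr egk exprD; ring.
exists e, (w + tau ^+ k * (e * h (k + i.+1)%N)); split=> //.
exact: (q_s (k.+1 + i.+1)%N _ _ k.+1 qw' egw).
Qed.

Lemma tower_no_quotient c (c_ : nat -> A) :
  (forall m, exists y a, c_ m = c + tau * y /\
     g m * (c_ m - \sum_(k < m) s k) = tau ^+ m * a) -> False.
Proof.
move=> cP.
pose sigma i := \sum_(k < i.+1) r k.
have qc i : q i (c - inclR (sigma i)).
  have [[qp qR] _ _ _] := qP i; have [qi _ _] := qp.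
  have qt : q i tau by apply/qR.
  (* At this index [tau ^ (i + 2)] divides the product while [g] accounts only for [tau ^ (i + 1)],
     so the other factor is in [q i]. *)
  have [y [a [cE ga]]] := cP (1 + i.+1)%N.
  have [e [w [qe qw egm _]]] := tower_valuation i 1.
  have qcs : q i (c_ (1 + i.+1)%N - \sum_(k < 1 + i.+1) s k).
    have : w * (c_ (1 + i.+1)%N - \sum_(k < 1 + i.+1) s k) = tau * (e * a).
      apply: (absint_expI (n := i.+1) tau0).
      by rewrite mulrA -egm -mulrA ga exprD; ring.
    move=> wE; have [_ _ qm] := qp.
    have : q i (w * (c_ (1 + i.+1)%N - \sum_(k < 1 + i.+1) s k)).
      by rewrite wE; exact: set_idealMr.
    by case/qm.
  move: qcs; rewrite cE add1n big_ord_recr /=.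
  have [_ [_ [_ _ _ qsi]]] := tower_valuation i 0.
  move=> qcs.
  have -> : c - inclR (sigma i) =
     (c + tau * y - (\sum_(k < i.+1) s k + s i.+1)) - tau * y + s i.+1
       + \sum_(k < i.+1) (s k - inclR (r k)).
    by rewrite sumrB rmorph_sum /=; ring.
  apply: set_idealD => //; last first.
    by apply: set_ideal_sum => // k _; apply: qs; rewrite -ltnS.
  apply: set_idealD => //; apply: set_idealB => //; exact: set_idealMr.
have [F Fm Fc] := absint_integral c.
apply: (monic_no_roots_mod_prime (r := sigma) Pp Fm) => [i j ij|i].
  exact: sign_power_sum.
have [[qp qR] _ _ _] := qP i; have [qi _ _] := qp.
apply/qR; rewrite -horner_map /=.
have : root (map_poly inclR F - (map_poly inclR F).[c]%:P) c by rewrite /root !hornerE subrr.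
rewrite Fc subr0 => /factor_theorem[G ->].
rewrite hornerM hornerXsubC; apply: set_idealMl => //.
by rewrite -opprB; exact: set_idealN.
Qed.

End Contradiction.
End Tower.

(** * Completions and valuations *)

Section CompletionTheory.
Variables (p : nat) (S : comPzRingType).
Hypothesis p_reg : forall n (a b : S), p%:R ^+ n * a = p%:R ^+ n * b -> a = b.
Implicit Types (f : completion p S) (n : nat).

Lemma cpl_limit (u : nat -> S) :
  (forall n, u n.+1 - u n \in principal (p%:R ^+ n)) ->
  exists l : completion p S, forall n, l n = to_pquot (p%:R ^+ n) (u n).
Proof.
move=> uP.
have compat n : Smod_red (to_pquot (p%:R ^+ n.+1) (u n.+1) : Smod p S n.+1) =
    to_pquot (p%:R ^+ n) (u n) by rewrite Smod_redE; exact/to_pquotP.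
by exists (Completion compat).
Qed.

Lemma cpl_repr_le f m n : (m <= n)%N ->
  f m = to_pquot (p%:R ^+ m) (pquot_repr (f n)).
Proof.
elim: n => [|n IHn]; first by rewrite leqn0 => /eqP ->; rewrite pquot_reprK.
rewrite leq_eqVlt => /orP[/eqP ->|]; first by rewrite pquot_reprK.
rewrite ltnS => mn; rewrite (IHn mn); apply/to_pquotP.
have /to_pquotP/principalP[y ->] :
    to_pquot (p%:R ^+ n) (pquot_repr (f n)) = to_pquot (p%:R ^+ n) (pquot_repr (f n.+1)).
  by rewrite pquot_reprK -(cpl_compat f n).
by apply/principalP; exists (p%:R ^+ (n - m) * y); rewrite mulrA -exprD subnKC.
Qed.

(** Representatives of [f] modulo [p ^ (k + n)] are of the form [p ^ n w k]; cancelling [p ^ n]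
    shows that the [w k] define an element of the completion. *)
Lemma cpl_dvd f n : f n = 0 -> exists y, f = p%:R ^+ n * y.
Proof.
move=> fn0.
have dvd k : exists y, pquot_repr (f (k + n)%N) = p%:R ^+ n * y.
  apply/principalP; rewrite -[pquot_repr _]subr0; apply/to_pquotP.
  by rewrite raddf0 -cpl_repr_le ?leq_addl.
have [w wP] := choice dvd.
have [|y yP] := @cpl_limit w.
  move=> k; have : pquot_repr (f (k.+1 + n)%N) - pquot_repr (f (k + n)%N)
      \in principal (p%:R ^+ (k + n)).
    by apply/to_pquotP; rewrite pquot_reprK -cpl_repr_le.
  rewrite !wP -mulrBr addnC => /principalP[z zP]; apply/principalP; exists z.
  by apply: (p_reg (n := n)); rewrite zP exprD mulrA.
exists y; apply: cpl_eqP => m.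
have -> : (p%:R ^+ n * y : completion p S) = to_cpl p (p%:R ^+ n) * y.
  by rewrite rmorphXn rmorph_nat.
have -> : (to_cpl p (p%:R ^+ n) * y) m = to_pquot (p%:R ^+ m) (p%:R ^+ n) * y m by [].
by rewrite (cpl_repr_le f (leq_addr n m)) wP rmorphM yP.
Qed.

End CompletionTheory.

Section Valuations.
Variables (F : realType) (p : nat) (S : comNzRingType).
Variable v : completion p S -> \bar F.
Hypotheses (vval : is_Rvaluation v) (vcent : has_center v) (vp : v p%:R = 1%E).
Local Open Scope ereal_scope.

Lemma center_prime : set_prime (center_on v (to_cpl p (S := S))).
Proof.
have [vNy v0 v1 vM vD] := vval.
split; rewrite /center_on /=.
- split=> [|a b va vb|a b vb]; rewrite /= ?raddf0 ?raddfD ?rmorphM ?v0 ?lt0y //=.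
  + by apply: lt_le_trans (vD _ _); rewrite lt_min va.
  + by rewrite vM; apply: lt_le_trans vb _; rewrite leeDr.
- by rewrite rmorph1 v1 ltxx.
- move=> a b; rewrite rmorphM vM => vab; apply: contrapT => /not_orP[/negP va /negP vb].
  move: vab; rewrite -leNgt in va; rewrite -leNgt in vb.
  by rewrite ltNge adde_le0.
Qed.

Lemma notin_centerP a : ~ center_on v (to_cpl p (S := S)) a <-> v (to_cpl p a) = 0.
Proof.
rewrite /center_on /=; split=> [/negP|->]; last by rewrite ltxx.
by rewrite -leNgt => va; apply/eqP; rewrite eq_le va vcent.
Qed.

Lemma valuation_prX n : v (p%:R ^+ n)%R = n%:R%:E.
Proof.
have [_ _ v1 vM _] := vval.
elim: n => [|n IHn]; first by rewrite expr0 v1.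
by rewrite exprSr vM IHn vp -natr1 EFinD.
Qed.

Lemma valuation_limit (l : completion p S) (g : nat -> S) :
  (forall n : nat, n%:R%:E <= v (to_cpl p (g n))) ->
  (forall n, exists y, l - to_cpl p (g n) = p%:R ^+ n * y)%R -> v l = +oo.
Proof.
have [_ _ _ vM vD] := vval.
move=> vg lg; have vl n : (n%:R%:E <= v l).
  have [y ly] := lg n; rewrite -(subrK (to_cpl p (g n)) l).
  apply: le_trans (vD _ _); rewrite le_min vg andbT ly vM valuation_prX.
  by rewrite leeDl.
case: (v l) (vcent l) vl => [r| |] // _ vl.
have := vl (Num.bound `|r|)%R; rewrite lee_fin.
by rewrite leNgt (le_lt_trans (ler_norm r)) // archi_boundP.
Qed.

End Valuations.

Section LocalRings.
Variable R : idomainType.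
Hypothesis noethR : noetherian R.
Variable m : idealr R.
Hypothesis mlocal : local_ring m.

Lemma mixed_char_residue p : mixed_char p m -> (p%:R : R) != 0 /\ (p%:R : R) \in m.
Proof.
move=> [chR chm]; have pp := pcharf_prime chm; split.
  by apply/negP => p0; have := chR p; rewrite !inE pp p0.
rewrite -[p%:R]subr0 Quotient.idealrBE raddf0 rmorph_nat.
by apply/eqP; exact: pcharf0.
Qed.

Lemma prime_sub_local P : set_prime P -> P `<=` [set z | z \in m].
Proof.
move=> [Pi P1 _] z Pz /=; apply: contraT => /(local_unit mlocal)[w wz].
by case: P1; rewrite -wz; exact: set_idealMl.
Qed.

Lemma prime_idealr_set_prime (J : prime_idealr R) : set_prime [set z | z \in J].
Proof.
split; rewrite /=.
- split=> /= [|x y|a x]; [exact: rpred0|exact: rpredD|exact: idealMr].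
- by rewrite idealr1.
- by move=> a b; rewrite prime_idealrM => /orP.
Qed.

(** If [P] contained [m], a nonzero [y] in [J 1] would divide a power of [t] at [P] by the principal
    ideal theorem. Then [t] is in [J 1], and the minimality of [P] leaves no room for [J 2]. *)
Lemma nonmaximal_min_prime t : krull_dim_ge R 2 -> t != 0 -> t \in m ->
  exists P x, [/\ min_prime_over t P, ~ P x & forall r, ~ P (1 + x * r)].
Proof.
move=> [J JP] t0 tm.
have [P Pmin] := exists_min_prime noethR (fun w => local_nonunit (w := w) tm).
have [Pp Pt _] := Pmin; have Pm := prime_sub_local Pp.
have [x xm Px] : exists2 x, x \in m & ~ P x.
  apply: contrapT => nx.
  have mP z : z \in m -> P z by move=> zm; apply: contrapT => Pz; apply: nx; exists z.
  have [J01 nJ10] := JP 0%N isT; have [J12 nJ21] := JP 1%N isT.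
  have [y [yJ1 yJ0]] : exists y, y \in J 1%N /\ y \notin J 0%N.
    apply: contrapT => ny; apply: nJ10 => y yJ1; apply: contraT => yJ0.
    by case: ny; exists y.
  have y0 : y != 0 by apply: contraNneq yJ0 => ->; exact: idealr0.
  have [k [u [r [Pu utk]]]] := principal_ideal_thm noethR Pmin y0.
  have J1p := prime_idealr_set_prime (J 1%N); have [J1i _ J1m] := J1p.
  have J1t : t \in J 1%N.
    have : u * t ^+ k \in J 1%N by rewrite utk mulrC idealMr.
    by case/J1m => [/(prime_sub_local J1p)/mP //|]; exact: set_primeX.
  apply: nJ21 => z zJ2; have := prime_sub_local (prime_idealr_set_prime (J 2%N)) zJ2.
  by move=> /mP; exact: (min_prime_eq Pmin J1p J1t (fun z zJ1 => mP z (prime_sub_local J1p zJ1))).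
exists P, x; split=> // r /Pm /= xr.
by have := rpredB xr (idealMr r xm); rewrite mulrC addrK idealr1.
Qed.

End LocalRings.

(** * Construction of the elements of the completion *)

Section Assembly.
Variables (p : nat) (R : idomainType) (K : closedFieldType).
Variable phi : {rmorphism {fraction R} -> K}.
Local Notation A := (absint phi).
Local Notation inclR := (inclR phi).
Hypothesis p0 : (p%:R : R) != 0.
Implicit Types (x y z : A).

Let pA0 : (p%:R : A) != 0. Proof. by rewrite -(rmorph_nat inclR) inclR_eq0. Qed.

Lemma absint_p_reg n (a b : A) : p%:R ^+ n * a = p%:R ^+ n * b -> a = b.
Proof. exact: absint_expI. Qed.

(* The sum of the [g s_k] is in the closure of the ideal [(g)], not in [(g)]. *)
Lemma exists_not_separated (t x b : R) (P Q : set R) : noetherian R -> t = p%:R ->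
  min_prime_over t P -> min_prime_over x Q -> ~ P x -> P b -> ~ Q b ->
  (forall r, ~ P (1 + x * r)) ->
  exists g : completion p A, ~ padically_separated p (pquot g).
Proof.
move=> noethR tp Pmin Qmin Px Pb Qb xunit.
have t0 : t != 0 by rewrite tp.
have [g [s [u [beta [h [q [r [n [gS gs hh qP [qs rn nS]]]]]]]]]] :=
  exists_tower phi noethR Pmin Qmin Px Pb Qb.
have tauE : inclR t = p%:R by rewrite tp rmorph_nat.
pose Z m := \sum_(k < m) g m * s k.
have [|G GP] := @cpl_limit p A g.
  by move=> i; rewrite gS tauE addrAC subrr add0r; apply/principalP; exists (h i).
have gle i k : exists y, g (i + k)%N = g i + p%:R ^+ i * y.
  elim: k => [|k [y gik]]; first by exists 0; rewrite addn0 mulr0 addr0.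
  exists (y + p%:R ^+ k * h (i + k)%N).
  by rewrite addnS gS gik tauE exprD; ring.
have gsdvd i k : (k <= i)%N -> exists y, g i * s k = p%:R ^+ k * y.
  move=> ki; have [y] := gle k (i - k)%N; rewrite subnKC // => ->.
  exists (p%:R * u k + y * s k); rewrite mulrDl gs tauE exprSr; ring.
have ZS i : Z i.+1 - Z i \in principal (p%:R ^+ i).
  have [y yP] := gsdvd i.+1 i (leqnSn i); apply/principalP.
  exists (y + \sum_(k < i) h i * s k).
  rewrite /Z big_ord_recr /= yP mulrDr mulr_sumr addrAC -sumrB addrC; congr (_ + _).
  by apply: eq_bigr => k _; rewrite gS tauE; ring.
have [ZZ ZP] := cpl_limit ZS.
exists G => sep.
(* At level [k] the limit [ZZ] is [G] times the partial sum of the [s j], so the difference of the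
   two is a multiple of [p ^ k]. *)
have Zdiv k : exists y : pquot G, to_pquot G ZZ = y *+ (p ^ k).
  pose a := to_cpl p (\sum_(j < k) s j).
  have [|y yP] := @cpl_dvd p A absint_p_reg (ZZ - G * a) k.
    have -> : (ZZ - G * a) k = ZZ k - G k * to_pquot (p%:R ^+ k) (\sum_(j < k) s j) by [].
    by rewrite ZP GP -rmorphM mulr_sumr subrr.
  exists (to_pquot G y); rewrite -rmorphMn; apply/to_pquotP/principalP; exists a.
  by rewrite -mulr_natl natrX -yP opprB addrC subrK.
have /to_pquotP/principalP[B] : to_pquot G ZZ = to_pquot G 0.
  by rewrite raddf0; exact: sep.
rewrite subr0 => ZB.
(* Level [m.+1] keeps each representative congruent to that of [B 1] modulo [p], also for [m = 0]:
   level 0 is the zero ring. *)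
apply: (tower_no_quotient Pmin t0 Px xunit gS gs hh qP qs rn nS
  (c := pquot_repr (B 1%N)) (c_ := fun m => pquot_repr (B m.+1))) => m.
have /to_pquotP/principalP[y yP] :
    to_pquot (p%:R ^+ 1) (pquot_repr (B m.+1)) = to_pquot (p%:R ^+ 1) (pquot_repr (B 1%N)).
  by rewrite pquot_reprK -cpl_repr_le.
have /to_pquotP/principalP[a aP] : to_pquot (p%:R ^+ m) (Z m) =
    to_pquot (p%:R ^+ m) (g m * pquot_repr (B m.+1)).
  rewrite -ZP ZB; have -> : (G * B) m = G m * B m by [].
  by rewrite GP (cpl_repr_le B (leqnSn m)) -rmorphM.
exists y, (- a); rewrite tauE; split.
  by rewrite -[p%:R * y]/(p%:R ^+ 1 * y) -yP addrC subrK.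
by rewrite mulrN -aP opprB mulrBr mulr_sumr.
Qed.

(* The roots of [T ^ 2 + s_i T + p] are [h_i] and [- s_i - h_i]; the second is *)
(* not in [q], and [s_(i + 1) = - s_i (- s_i - h_i) ^ 2].                      *)
Lemma exists_root_sequence (q : set A) x : set_prime q -> q p%:R -> ~ q x ->
  exists g s h : nat -> A,
    [/\ g 0%N ^+ 2 + x * g 0%N + p%:R ^+ 2 = 0,
      forall i, g i * s i = p%:R ^+ i.+2 /\ ~ q (s i),
      forall i, g i.+1 = g i + p%:R ^+ i.+1 * h i /\ h i ^+ 2 + s i * h i + p%:R = 0 &
      s 0%N = - x - g 0%N].
Proof.
move=> qp qpr qx; have [qi q1 qm] := qp.
have roots y c : ~ q y -> q c -> exists z w, [/\ z + w = - y, z * w = c & ~ q w].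
  move=> qy qc; have [z [w [zw zwc]]] := absint_quadratic y c.
  have nzw : ~ (q z /\ q w).
    by case=> qz qw; apply: qy; rewrite -[y]opprK -zw; apply: set_idealN => //; exact: set_idealD.
  have [qw|qw] := pselect (q w); last by exists z, w.
  exists w, z; split; [by rewrite addrC|by rewrite mulrC|by move=> qz; apply: nzw].
have [g0 [s0 [gs0 gs0p qs0]]] : exists z w, [/\ z + w = - x, z * w = p%:R ^+ 2 & ~ q w].
  by apply: roots => //; exact: set_idealX.
have : forall s, exists h, ~ q s -> h ^+ 2 + s * h + p%:R = 0 /\ ~ q (- s - h).
  move=> s; have [qs|qs] := pselect (q s); first by exists 0.
  have [h [w [hw hwp qw]]] := roots s p%:R qs qpr; exists h => _.
  have wE : w = - s - h by rewrite -hw addrAC subrr add0r.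
  split; last by rewrite -wE.
  by rewrite -hwp wE; ring.
move=> /choice[hf hfP].
pose s i := iter i (fun s => - s * (- s - hf s) ^+ 2) s0.
pose g i := g0 + \sum_(k < i) p%:R ^+ k.+1 * hf (s k).
have gS i : g i.+1 = g i + p%:R ^+ i.+1 * hf (s i) by rewrite /g big_ord_recr addrA.
have sS i : s i.+1 = - s i * (- s i - hf (s i)) ^+ 2 by [].
have qs i : ~ q (s i).
  elim: i => // i IHi; rewrite sS; apply: set_primeNM => //.
    by move=> /(set_idealN qi); rewrite opprK.
  by apply: set_primeNX => //; case: (hfP (s i) IHi).
have g0E : g 0%N = g0 by rewrite /g big_ord0 addr0.
exists g, s, (fun i => hf (s i)); split.
- have s0E : s0 = - x - g0 by rewrite -gs0 addrAC subrr add0r.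
  by rewrite g0E -gs0p s0E; ring.
- move=> i; split=> //; elim: i => [|i IHi]; first by rewrite g0E.
  have [hE _] := hfP (s i) (qs i); rewrite gS sS.
  set h := hf (s i) in hE *.
  have pE : p%:R = h * (- s i - h).
    by apply/eqP; rewrite eq_sym -subr_eq0 -oppr_eq0 -hE; apply/eqP; ring.
  have -> : (g i + p%:R ^+ i.+1 * h) * (- s i * (- s i - h) ^+ 2) =
    - (g i * s i) * (- s i - h) ^+ 2 - p%:R ^+ i.+1 * s i * (- s i - h) * (h * (- s i - h)) by ring.
  rewrite IHi -pE.
  have -> : - p%:R ^+ i.+2 * (- s i - h) ^+ 2 - p%:R ^+ i.+1 * s i * (- s i - h) * p%:R =
    p%:R ^+ i.+2 * (h * (- s i - h)) by rewrite !exprS; ring.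
  by rewrite -pE [RHS]exprSr.
- by move=> i; split=> //; case: (hfP (s i) (qs i)).
- by rewrite g0E -gs0 addrAC subrr add0r.
Qed.

(** Dividing by [p] gives [x y = - p (y ^ 2 + 1)], so [y] is a multiple of [p] by regularity;
    dividing by [p] again expresses 1 through [p] and [x]. *)
Lemma regular_sequence_neq0 x y : regular_sequence [:: p%:R; x] ->
  (p%:R * y) ^+ 2 + x * (p%:R * y) + p%:R ^+ 2 = 0 -> False.
Proof.
move=> [reg nunit] eq1.
have gen1 z w : z = p%:R * w -> gen_ideal (take 1 [:: p%:R; x]) z.
  by move=> ->; exists (fun=> w); rewrite big_ord1 mulrC.
have eq2 : x * y = p%:R * (- (y ^+ 2) - 1).
  apply: (absint_p_reg (n := 1)); apply/eqP; rewrite -subr_eq0 -eq1; apply/eqP.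
  by ring.
have [c] := reg 1%N isT y (gen1 _ _ eq2); rewrite big_ord1 /= => yE.
apply: nunit; exists (fun i => if i == 0%N then - (p%:R * c 0%N ^+ 2) else - c 0%N).
rewrite !big_ord_recl big_ord0 /= addr0.
have eq3 : p%:R * (- (p%:R * c 0%N ^+ 2) * p%:R + (- c 0%N) * x) = p%:R * 1.
  apply/eqP; rewrite -subr_eq0 -oppr_eq0; apply/eqP.
  have : x * y - p%:R * (- (y ^+ 2) - 1) = 0 by rewrite eq2 subrr.
  by move=> <-; rewrite yE; ring.
by rewrite (absint_mulI pA0 eq3).
Qed.

(* Read the integral equation of [z] modulo [q], starting from its first      *)
(* coefficient outside of [q].                                                *)
Lemma exists_inclR_notin_prime (q : set A) z : set_prime q -> ~ q z ->
  exists r w, ~ q (inclR r) /\ q (inclR r + w * z).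
Proof.
move=> qp qz; have [qi q1 qm] := qp; have [G Gm Gz] := absint_integral z.
have : exists i, ~ q (inclR G`_i).
  by exists (size G).-1; move: Gm;
     rewrite monicE => /eqP; rewrite /lead_coef => ->; rewrite rmorph1.
have : q (map_poly inclR G).[z] by rewrite Gz; case: qi.
elim/poly_ind: G {Gm Gz} => [|G c IHG] qG [i qGi].
  by case: qGi; rewrite coef0 rmorph0; case: qi.
move: qG; rewrite rmorphD rmorphM /= map_polyX map_polyC !hornerE /= => qG.
have [qc|qc] := pselect (q (inclR c)); last first.
  by exists c, (map_poly inclR G).[z]; split=> //; rewrite addrC.
apply: IHG.
  by rewrite addrC in qG; case/qm: (set_ideal_addl qi qc qG).
case: i qGi => [|i]; rewrite coefD coefMX coefC /=; first by rewrite add0r.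
by rewrite addr0 => qGi; exists i.
Qed.

Section Value.
Variables (F : realType) (v : completion p A -> \bar F).
Hypotheses (vval : is_Rvaluation v) (vcent : has_center v) (vp : v p%:R = 1%E).
Local Notation center := (center_on v (to_cpl p (S := A))).

Let vpA : center p%:R. Proof. by rewrite /center_on /= rmorph_nat vp lte01. Qed.

Lemma exists_support x : ~ center x ->
  exists (g : completion p A) (g_ s h : nat -> A),
    [/\ v g = +oo%E, padic_limit p (fun i => to_cpl p (g_ i)) g,
        g = 0 -> exists y,
          [/\ g_ 1%N = p%:R * y, center y & s 1%N = - x - g_ 1%N /\ y * s 1%N = p%:R] &
    [/\ g_ 1%N ^+ 2 + x * g_ 1%N + p%:R ^+ 2 = 0,
      forall i, (1 <= i)%N ->
        absint_val (g_ i) = p%:R ^+ i.+1 / absint_val (s i) /\ v (to_cpl p (s i)) = 0%E &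
      forall i, (1 <= i)%N ->
        g_ i.+1 = g_ i + p%:R ^+ i * h i /\ h i ^+ 2 + s i * h i + p%:R = 0]].
Proof.
move=> cx; have cp := center_prime vval vcent; have [ci _ cm] := cp.
have [g [s [h [g0 gsP ghP s0]]]] := exists_root_sequence cp vpA cx.
have vs i : v (to_cpl p (s i)) = 0%E by apply/(notin_centerP vcent); case: (gsP i).
have vg i : v (to_cpl p (g i)) = i.+2%:R%:E.
  have [_ _ _ vM _] := vval.
  have := congr1 (fun z => v (to_cpl p z)) (gsP i).1.
  by rewrite rmorphM vM vs adde0 => ->; rewrite rmorphXn rmorph_nat; exact: valuation_prX.
have [|l lP] := @cpl_limit p A g.
  move=> i; have [-> _] := ghP i; rewrite addrAC subrr add0r.
  by apply/principalP; exists (p%:R * h i); rewrite exprSr mulrA.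
have lg i : exists y : completion p A, l - to_cpl p (g i) = p%:R ^+ i.+1 * y.
  apply: cpl_dvd; first exact: absint_p_reg.
  have -> : (l - to_cpl p (g i)) i.+1 = l i.+1 - to_pquot (p%:R ^+ i.+1) (g i) by [].
  rewrite lP -raddfB -[RHS](raddf0 (to_pquot (p%:R ^+ i.+1))); apply/to_pquotP.
  have [-> _] := ghP i; rewrite subr0 addrAC subrr add0r.
  by apply/principalP; exists (h i).
(* The sequences built above start at 0, those of the statement at 1. *)
exists l, (fun i => g i.-1), (fun i => s i.-1), (fun i => h i.-1); split.
- apply: (valuation_limit vval vcent vp (g := g)) => [n|n].
    by rewrite vg lee_fin ler_nat leqW // leqW.
  by have [y ->] := lg n; exists (p%:R * y); rewrite exprSr mulrA.
- move=> n; exists n.+1 => -[//|i]; rewrite ltnS => ni /=.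
  have [y ->] := lg i; apply/principalP; exists (p%:R ^+ (i.+1 - n) * y).
  by rewrite mulrA -exprD subnKC // leqW.
- move=> l0 /=; have [y gy] : exists y, g 0%N = p%:R * y.
    have /to_pquotP/principalP[y] : to_pquot (p%:R ^+ 1 : A) (g 1%N) = to_pquot (p%:R ^+ 1) 0.
      by rewrite -lP l0 raddf0.
    rewrite subr0; have [-> _] := ghP 0%N => gy; exists (y - h 0%N).
    by rewrite mulrBr -[X in X * y]expr1 -gy expr1 addrK.
  have ysp : y * s 0%N = p%:R.
    have [gs _] := gsP 0%N.
    by apply: (absint_p_reg (n := 1)); rewrite mulrA expr1 -gy gs expr2.
  exists y; split=> //.
  have : center (y * s 0%N) by rewrite ysp.
  by case/cm => // cs; case: (gsP 0%N).
- split=> //= -[//|i] _ /=; last exact: ghP.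
  have [gs cs] := gsP i; split; last exact: vs.
  have s0' : absint_val (s i) != 0.
    apply: contra_notN cs => /eqP si; have -> : s i = 0 by exact: val_inj.
    by case: ci.
  have /(congr1 val) := gs; rewrite rmorphM rmorphXn rmorph_nat => <-.
  by rewrite mulfK.
Qed.

Hypothesis noethR : noetherian R.
Variable mplus : idealr A.
Hypothesis mlocal : local_ring mplus.

Lemma center_sub_local : center `<=` [set z | z \in mplus].
Proof.
have [ci c1 cm] := center_prime vval vcent.
move=> z cz /=; apply: contraT => /(local_unit mlocal)[w wz].
by case: c1; rewrite -wz; exact: set_idealMl.
Qed.

(** Take a nonunit [r] of [R] outside of the center and [P] minimal over [r]. The principal ideal
    theorem gives [u r ^ k = p s] with [u] outside [P]; if [r ^ (k + 1)] divided [p], then [r] would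
    divide [u]. *)
Lemma exists_not_dvd_p : center <> [set z | z \in mplus] ->
  exists x, [/\ x \in mplus, ~ center x & forall c, p%:R <> x * c].
Proof.
move=> cneq; have cp := center_prime vval vcent; have [ci c1 cm] := cp.
have [z zm cz] : exists2 z, z \in mplus & ~ center z.
  apply: contrapT => nz; apply: cneq; apply/seteqP; split; first exact: center_sub_local.
  by move=> z zm; apply: contrapT => cz; apply: nz; exists z.
have [r [w [cr crw]]] := exists_inclR_notin_prime cp cz.
have rm : inclR r \in mplus.
  have := rpredB (center_sub_local crw) (idealMr w zm).
  by rewrite addrK.
have [P Pmin] : exists P, min_prime_over r P.
  apply: exists_min_prime noethR _ _ => s sr; apply: (local_nonunit (w := inclR s) rm).
  by rewrite -rmorphM /= sr rmorph1.
have [k [u [s [Pu urk]]]] := principal_ideal_thm noethR Pmin p0.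
have r0 : inclR r != 0 by apply/eqP => r0; apply: cr; rewrite r0; case: ci.
exists (inclR r ^+ k.+1); split.
- by rewrite exprSr; exact: idealMr.
- exact: set_primeNX.
move=> c pE; apply: Pu; apply: (inclR_dvd_min_prime Pmin (b := c * inclR s)).
apply: (absint_expI (n := k) r0); rewrite -rmorphXn -rmorphM mulrC urk rmorphM rmorph_nat pE.
by rewrite exprSr rmorphXn /=; ring.
Qed.

(** As [y s = p], the formula for [s] reads [x = - s (1 + y ^ 2)] with [1 + y ^ 2] a unit; so [x]
    divides [s], which divides [p]. *)
Lemma not_dvd_p_neq0 x y s : x \in mplus -> center y -> (forall c, p%:R <> x * c) ->
  s = - x - p%:R * y -> y * s = p%:R -> False.
Proof.
move=> xm /center_sub_local ym xp sE ys.
have [|w wy] := @local_unit _ _ (1 + y ^+ 2) mlocal.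
  apply/negP => y1; have := rpredB y1 (idealMr y ym).
  by rewrite -expr2 addrK idealr1.
have xE : x * w = - s.
  have -> : x = - s * (1 + y ^+ 2).
    have -> : - s * (1 + y ^+ 2) = - s - y * s * y by ring.
    by rewrite ys sE; ring.
  by rewrite -mulrA [_ * w]mulrC wy mulr1.
by apply: (xp (- (w * y))); rewrite mulrN mulrA xE mulNr opprK mulrC.
Qed.

End Value.
End Assembly.

Theorem proposition4p10 (p : nat) (R : idomainType) (m : idealr R)
    (K : closedFieldType) (phi : {rmorphism {fraction R} -> K})
    (mplus : idealr (absint phi)) :
  prime p ->
  noetherian R ->
  local_ring m ->
  adically_complete m ->
  mixed_char p m ->
  krull_dim_ge R 2 ->
  algebraic_closure phi ->
  local_ring mplus ->
  (forall (F : realType) (v : completion p (absint phi) -> \bar F),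
     is_Rvaluation v ->
     has_center v ->
     center_on v (to_cpl p (S := absint phi)) p%:R ->
     center_on v (to_cpl p (S := absint phi)) <> [set z | z \in mplus] ->
     v p%:R = 1%E ->
     (exists g : completion p (absint phi), g != 0 /\ v g = +oo%E) /\
     (forall x : absint phi,
        x \in mplus ->
        regular_sequence [:: p%:R; x] ->
        ~ center_on v (to_cpl p (S := absint phi)) x ->
        exists (g : completion p (absint phi)) (g_ s h : nat -> absint phi),
          [/\ g != 0,
              v g = +oo%E &
              padic_limit p (fun i => to_cpl p (g_ i)) g] /\
          [/\ g_ 1%N ^+ 2 + x * g_ 1%N + p%:R ^+ 2 = 0,
              forall i, (1 <= i)%N ->
                absint_val (g_ i) = p%:R ^+ i.+1 / absint_val (s i) /\
                v (to_cpl p (s i)) = 0%E &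
              forall i, (1 <= i)%N ->
                g_ i.+1 = g_ i + p%:R ^+ i * h i /\
                h i ^+ 2 + s i * h i + p%:R = 0])) /\
  (exists g : completion p (absint phi), ~ padically_separated p (pquot g)).
Proof.
move=> _ noethR mlocal _ mixed dim2 _ mpluslocal.
have [p0 pm] := mixed_char_residue mixed.
split=> [F v vval vcent _ cneq vp|].
  (* Both claims about [v] rest on this construction and differ only in the reason why the limit is
     nonzero. *)
  have witness x : ~ center_on v (to_cpl p (S := absint phi)) x ->
      (forall y s, center_on v (to_cpl p (S := absint phi)) y ->
         (p%:R * y) ^+ 2 + x * (p%:R * y) + p%:R ^+ 2 = 0 ->
         s = - x - p%:R * y -> y * s = p%:R -> False) ->
      exists (g : completion p (absint phi)) (g_ s h : nat -> absint phi),
          [/\ g != 0,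
              v g = +oo%E &
              padic_limit p (fun i => to_cpl p (g_ i)) g] /\
          [/\ g_ 1%N ^+ 2 + x * g_ 1%N + p%:R ^+ 2 = 0,
              forall i, (1 <= i)%N ->
                absint_val (g_ i) = p%:R ^+ i.+1 / absint_val (s i) /\
                v (to_cpl p (s i)) = 0%E &
              forall i, (1 <= i)%N ->
                g_ i.+1 = g_ i + p%:R ^+ i * h i /\
                h i ^+ 2 + s i * h i + p%:R = 0].
    move=> cx nzero.
    have [g [g_ [s [h [vg glim g0 gP]]]]] := exists_support p0 vval vcent vp cx.
    exists g, g_, s, h; split=> //; split=> //; apply/eqP => /g0[y [gy cy [sE ys]]].
    have [g1 _ _] := gP; rewrite gy in g1 sE.
    exact: (nzero y (s 1%N) cy g1 sE ys).
  split=> [|x _ reg cx].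
    have [x [xm cx xp]] := exists_not_dvd_p p0 vval vcent noethR mpluslocal cneq.
    have [|g [_ [_ [_ [[g0 vg _] _]]]]] := witness x cx; last by exists g.
    by move=> y s cy _; exact: (not_dvd_p_neq0 vval vcent mpluslocal xm cy xp).
  apply: witness => // y s _ eq1 _ _; exact: (regular_sequence_neq0 p0 reg eq1).
have [P [x [Pmin Px xunit]]] := nonmaximal_min_prime noethR mlocal dim2 p0 pm.
have [Pp Pt _] := Pmin; have [Pi P1 _] := Pp.
have [Q Qmin] : exists Q, min_prime_over x Q.
  apply: (exists_min_prime noethR) => w wx; apply: (xunit (- w)).
  by rewrite mulrN mulrC wx subrr; case: Pi.
have [Qp Qx _] := Qmin; have [_ _ Qm] := Qp.
(* This [u] serves as the element [b]: it is outside [Q], and it is in [P] because [P] contains [p]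
   and not [x]. *)
have [k [u [r [Qu uxk]]]] := principal_ideal_thm noethR Qmin p0.
have Pu : P u.
  have [_ _ Pm] := Pp.
  have /Pm[//|/(set_primeX Pp)//] : P (u * x ^+ k) by rewrite uxk; exact: set_idealMr.
exact: (exists_not_separated phi p0 noethR erefl Pmin Qmin Px Pu Qu xunit).
Qed.
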